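(* Let $d\ge2$ and let $A,B\in M_d(\mathbb{Z})$ with $\det(A)\ne0$ and $\det(B)\neq0$. Suppose that (a) $A$ is similar in $M_d(\mathbb{C})$ to a diagonal matrix $D=\mathrm{diag}(\lambda_1,\dots,\lambda_d)$, where $|\lambda_j|\neq1$ for $1\le j\le d$; and that either (b) $\det(A)$ and $\det(B)$ are relatively prime; or (b') $A$ is upper or lower triangular. Then the set $$G_{A,B}:=\bigl\{\mu\in\mathcal{P}_{A,c}(\mathbb{T}^d)\;:\;T_{B^n}\mu\text{ does not converge }w^*\text{ to }\mathrm{Leb}_d\text{ as }n\to+\infty\bigr\}$$ is residual in $(\mathcal{P}_A(\mathbb{T}^d),w^* )$.
   Context: $\mathbb{T}^d=\mathbb{R}^d/\mathbb{Z}^d$. For $M\in M_d(\mathbb{Z})$ with $\det(M)\ne0$, $T_M:\mathbb{T}^d\to\mathbb{T}^d$ is the map $x\mapsto Mx\bmod 1$, and $T_M\mu$ is the push-forward of $\mu$ under $T_M$. $\mathcal{P}(\mathbb{T}^d)$ is the set of Borel probability measures on $\mathbb{T}^d$ with the topology of $w^*$-convergence (convergence of integrals of all continuous functions). $\mathcal{P}_A(\mathbb{T}^d)$ is the set of $T_A$-invariant measures $\mu\in\mathcal{P}(\mathbb{T}^d)$, with the induced topology (a compact metrizable space), and $\mathcal{P}_{A,c}(\mathbb{T}^d)$ is the set of those which are continuous, i.e. have no atom. $\mathrm{Leb}_d$ is the normalised Lebesgue measure on $\mathbb{T}^d$. A subset of a Polish space is residual if it contains a dense $G_\delta$ set. 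*)

(* Defs.v *)
From HB Require Import structures.
From mathcomp Require Import all_boot all_order all_algebra.
From mathcomp Require Import archimedean generic_quotient complex.
From mathcomp Require Import lra.
From mathcomp Require Import all_classical all_reals all_analysis.
From mathcomp Require Import borel_hierarchy.

Set Implicit Arguments.
Unset Strict Implicit.
Unset Printing Implicit Defensive.

Import Order.TTheory GRing.Theory Num.Theory.
Import numFieldNormedType.Exports.

Local Open Scope classical_set_scope.
Local Open Scope ring_scope.
Local Open Scope quotient_scope.

Section Torus.
Variables (R : realType) (d : nat).

(* The torus is the quotient of R^d by Z^d, with the quotient topology and the
   Borel sigma-algebra of that topology.
   Elements of R^d are column vectors, so that M acts by M *m x. *)
Definition torus_eq (x y : 'cV[R]_d) := (x - y) \is a mxOver Num.int.

Local Lemma torus_eq_refl : reflexive torus_eq.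
Proof. by move=> x; rewrite /torus_eq subrr; apply: mxOver0; exact: rpred0. Qed.

Local Lemma torus_eq_sym : symmetric torus_eq.
Proof.
by move=> x y; apply/mxOverP/mxOverP => H i j; have := H i j;
  rewrite -rpredN !mxE opprB.
Qed.

Local Lemma torus_eq_trans : transitive torus_eq.
Proof.
move=> y x z /mxOverP xy /mxOverP yz; apply/mxOverP => i j.
by rewrite -(subrKA y) mxE rpredD.
Qed.

Canonical torus_equiv :=
  EquivRel torus_eq torus_eq_refl torus_eq_sym torus_eq_trans.

Definition torus := {eq_quot torus_equiv}.

HB.instance Definition _ := Topological.copy torus (quotient_topology torus).
HB.instance Definition _ := Quotient.on torus.
HB.instance Definition _ := isPointed.Build torus (\pi_torus 0).

Definition torus_proj (x : 'cV[R]_d) : torus := \pi_torus x.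

Lemma torus_proj_continuous : continuous torus_proj.
Proof. exact: pi_continuous. Qed.

HB.instance Definition _ := @isMeasurable.Build (sigma_display (@open torus))
  torus <<s @open torus >> (@sigma_algebra0 _ setT _)
  (@sigma_algebraC _ _) (@sigma_algebra_bigcup _ setT _).

Definition toral_endo (M : 'M[int]_d) (x : torus) : torus :=
  torus_proj (map_mx intr M *m repr x).

Lemma torus_projP (x y : 'cV[R]_d) :
  torus_proj x = torus_proj y <-> (x - y) \is a mxOver Num.int.
Proof.
by split=> [/(@eqmodP _ torus_equiv)//|xy]; exact/(@eqmodP _ torus_equiv).
Qed.

Lemma toral_endo_proj (M : 'M[int]_d) (x : 'cV[R]_d) :
  toral_endo M (torus_proj x) = torus_proj (map_mx intr M *m x).
Proof.
apply/torus_projP; rewrite -mulmxBr.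
have /mxOverP xint : repr (torus_proj x) - x \is a mxOver Num.int.
  by apply/torus_projP; rewrite /torus_proj reprK.
apply/mxOverP => i j; rewrite mxE rpred_sum// => k _.
by rewrite rpredM// mxE intr_int.
Qed.

Lemma mulmx_cV_continuous (M : 'M[R]_d) :
  continuous (fun x : 'cV[R]_d => M *m x).
Proof.
move=> x A [P nP sPA]; have Fx : Filter (nbhs x) by exact: nbhs_filter.
suff : \forall y \near x, forall i j, P i j ((M *m y) i j).
  by apply: filterS => y Py; apply: sPA => i j; exact: Py.
apply: (@filter_forall _ 'I_d (fun i y => forall j, P i j ((M *m y) i j))
  (nbhs x) _ _) => i.
apply: (@filter_forall _ 'I_1 (fun j y => P i j ((M *m y) i j))
  (nbhs x) _ _) => j.
have : (M *m y) i j @[y --> x] --> (M *m x) i j.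
  rewrite mxE; under eq_fun do rewrite mxE.
  apply: (@cvg_big _ _ _ _ _ (fun z => @add_continuous _ z)
    _ (nbhs x) _ _ _ _) => k _.
  by apply: cvgMl_tmp; exact: coord_continuous.
by move/(_ _ (nP i j)).
Qed.

Lemma toral_endo_continuous (M : 'M[int]_d) : continuous (toral_endo M).
Proof.
apply/quotient_continuous.
rewrite (_ : _ \o _ = torus_proj \o (fun x => map_mx intr M *m x)).
  move=> x; apply: continuous_comp; first exact: mulmx_cV_continuous.
  exact: torus_proj_continuous.
by apply/funext => x; exact: toral_endo_proj.
Qed.

Lemma toral_endo_measurable (M : 'M[int]_d) :
  measurable_fun [set: torus] (toral_endo M).
Proof.
apply: (@measurability _ _ _ _ _ _ (@open torus)) => //.
move=> _ [U oU <-]; rewrite setTI; apply: sub_sigma_algebra.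
by move/continuousP: (@toral_endo_continuous M); exact.
Qed.

HB.instance Definition _ (M : 'M[int]_d) :=
  isMeasurableFun.Build _ _ _ _ (toral_endo M) (toral_endo_measurable M).

End Torus.

Arguments torus_proj {R d}.
Arguments toral_endo {R d}.

Section WeakStar.
Variables (R : realType) (d : nat).

Definition prob_torus := probability (torus R d) R.

(* The w*-topology: the coarsest topology making all the maps
   mu |-> \int[mu]_x f x continuous, f ranging over the continuous functions.
   A [probability] also carries unconstrained values on non-measurable sets.
   Two elements that agree on the Borel sets have the same neighbourhoods, so
   the open and G_delta sets are exactly the preimages of those of the usual
   (Hausdorff) space of Borel probability measures. *)
Definition prob_torus_eval (mu : prob_torus) :
    prod_topology (fun _ : continuousType (torus R d) R => R) :=
  fun f => (\int[mu]_x f x)%R.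

HB.instance Definition _ := Choice.on prob_torus.
HB.instance Definition _ :=
  Topological.copy prob_torus (initial_topology prob_torus_eval).

Lemma prob_torus_cvgP (F : set_system prob_torus) (mu : prob_torus) :
  Filter F ->
  F --> mu <-> forall f : torus R d -> R, continuous f ->
    (\int[nu]_x f x)%R @[nu --> F] --> (\int[mu]_x f x)%R.
Proof.
move=> FF; split=> [Fmu f cf|H].
  have cev : continuous (fun nu : prob_torus => prob_torus_eval nu (mkcts cf)).
    move=> nu; apply: (@continuous_comp _ _ _ prob_torus_eval (@^~ (mkcts cf))).
      exact: initial_continuous.
    exact: proj_continuous.
  exact: (cvg_comp _ _ Fmu (cev mu)).
suff Feval : prob_torus_eval @ F --> prob_torus_eval mu.
  move=> A; rewrite nbhsE => -[_ [[C oC <-] Cmu] CA].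
  apply: filterS CA _; apply: Feval; exact: open_nbhs_nbhs.
apply/cvg_sup => f A; rewrite nbhsE => -[_ [[C oC <-] Cmu] CA].
apply: filterS CA _; apply: (H f (@cts_fun _ _ f)); exact: open_nbhs_nbhs.
Qed.

Definition push_endo (M : 'M[int]_d) (mu : prob_torus) : prob_torus :=
  distribution mu (toral_endo M).

Definition invariant_prob (M : 'M[int]_d) : set prob_torus :=
  [set mu | forall S, measurable S -> push_endo M mu S = mu S].

Definition nonatomic (mu : prob_torus) := forall x, mu [set x] = 0%E.

End WeakStar.

Section Lebesgue.
Variable R : realType.

Definition cube_cons (n : nat)
  (p : measurableTypeR R * n.-tuple (measurableTypeR R)) :
  n.+1.-tuple (measurableTypeR R) := [tuple of p.1 :: p.2].

Lemma cube_cons_measurable n : measurable_fun setT (@cube_cons n).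
Proof. exact: measurable_cons. Qed.

HB.instance Definition _ n :=
  isMeasurableFun.Build _ _ _ _ (@cube_cons n) (@cube_cons_measurable n).

(* Lebesgue measure on the cube [0, 1]^n, as an iterated product measure. *)
Fixpoint cube_prob (n : nat) : probability (n.-tuple (measurableTypeR R)) R :=
  match n with
  | 0%N => \d_([tuple] : 0.-tuple (measurableTypeR R))
  | n.+1 =>
      distribution (uniform_prob (@ltr01 R) \x cube_prob n)%E (@cube_cons n)
  end.

Variable d : nat.

Definition tuple_torus (t : d.-tuple (measurableTypeR R)) : torus R d :=
  torus_proj (\col_i tnth t i).

Lemma tuple_torus_measurable : measurable_fun setT tuple_torus.
Proof.
apply: (@measurability _ _ _ _ _ _ (@open (torus R d))) => //.
move=> _ [U oU <-]; rewrite setTI.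
pose box (q : {ffun 'I_d -> rat * rat}) :=
  \bigcap_(i in [set: 'I_d]) [set t : d.-tuple (measurableTypeR R) |
    tnth t i \in `](ratr (q i).1 : R), ratr (q i).2[].
have boxP q t : box q t <->
    forall i, tnth t i \in `](ratr (q i).1 : R), ratr (q i).2[.
  by split=> [H i|H i _]; [exact: H|exact: H].
pose F q := if `[< box q `<=` tuple_torus @^-1` U >] then box q else set0.
have -> : tuple_torus @^-1` U = \bigcup_q F q.
  apply/seteqP; split=> [t Ut|t [q _]]; last first.
    by rewrite /F; case: asboolP => // qU; exact: qU.
  have [e e0 eU] : exists2 e, 0 < e &
      ball (\col_i tnth t i) e `<=` torus_proj @^-1` U.
    apply/nbhs_ballP; apply: open_nbhs_nbhs; split; last exact: Ut.
    have /continuousP := @torus_proj_continuous R d; exact.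
  have /choice[q qP] : forall i, exists q : rat * rat,
      [/\ ratr q.1 \in `](tnth t i - e / 2), tnth t i[ &
          ratr q.2 \in `](tnth t i), (tnth t i + e / 2)[].
    move=> i.
    have [q1 q1P] := @rat_in_itvoo R (tnth t i - e / 2) (tnth t i) ltac:(lra).
    have [q2 q2P] := @rat_in_itvoo R (tnth t i) (tnth t i + e / 2) ltac:(lra).
    by exists (q1, q2).
  exists (finfun q) => //; rewrite /F; case: asboolP => [_|nU].
    apply/boxP => i; by have [] := qP i; rewrite ffunE !in_itv/=; lra.
  exfalso; apply: nU => s /boxP sq; apply: eU; split=> // i j.
  have [] := qP i; have := sq i; rewrite !mxE ffunE !in_itv/= => *.
  by rewrite /ball /= ltr_norml; lra.
apply: countable_bigcupT_measurable; first exact: countableP.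
move=> q; rewrite /F; case: asboolP => // _.
apply: fin_bigcap_measurable => [|i _]; first exact: finite_finset.
have mi : measurable
  (`](ratr (q i).1 : R), ratr (q i).2[ : set (measurableTypeR R)).
  exact: measurable_itv.
by have := measurable_tnth i measurableT mi; rewrite setTI.
Qed.

HB.instance Definition _ :=
  isMeasurableFun.Build _ _ _ _ tuple_torus tuple_torus_measurable.

(* Normalised Lebesgue measure: the image of Lebesgue measure on the unit cube,
   a fundamental domain up to a null set. *)
Definition lebesgue_torus : prob_torus R d :=
  distribution (cube_prob d) tuple_torus.

End Lebesgue.

Definition residual (T : topologicalType) (S : set T) :=
  exists G : set T, [/\ Gdelta G, dense G & G `<=` S].

Arguments invariant_prob R {d}.

(* Main.v *)
Require Import Defs.
From HB Require Import structures.
From mathcomp Require Import all_boot all_order all_algebra.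
From mathcomp Require Import all_fingroup.
From mathcomp Require Import archimedean generic_quotient complex.
From mathcomp Require Import all_classical all_reals all_analysis.
From mathcomp Require Import borel_hierarchy.
From mathcomp Require Import measurable_realfun zify lra.

(** Why the set is residual.

    Let f be the distance to the origin.  If the mean of f for mu differs from
    its Lebesgue mean, and if the means of f for the measures B^n mu come back
    arbitrarily close to the mean for mu at arbitrarily large times n, then B^n mu
    cannot converge to Lebesgue measure.  These two properties and the absence of
    atoms follow from countably many open conditions ([generic_cond]).  What
    remains is a density statement: near every A-invariant measure there is an
    A-invariant measure that satisfies all these conditions.

    Rational approximation.  Put S_n = 1 + A + ... + A^(n-1).  Round S_n x to an
    integer vector z and let y be the solution of S_n y = z.  As
    (A^n - 1) y = (A - 1) z is an integer vector, y has period n on the torus,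
    whatever the point x.  The displacement v = y - x satisfies S_n v = z - S_n x,
    which is bounded, and the sum over k < n of the norms |A^k v| is at most a
    constant times |S_n v|, because A is diagonalisable without eigenvalues on the
    unit circle ([orbit_sum_le_geom]).  So the orbit of y shadows the orbit of x
    with a mean error O(1/n) ([shadowing]).  When n is congruent to 1 modulo a
    suitable integer, det S_n is prime to det B ([coprime_det_geom]); then y lies
    in a finite subgroup of the torus on which B acts as a permutation, and y is
    also periodic under B ([good_list_recurrent]).  Averaging over x, the
    invariant measures carried by finite lists of such points are seen to be
    dense ([good_list_approx]).

    Dissolving the atoms.  Shadowing the orbits of all points of an invariant list
    for a long time n replaces each point by n points, most of them close to it,
    while every point of the torus becomes a tiny fraction of the new list
    ([good_list_refine]).  Iterating with summable errors gives a sequence of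
    lists which, read as step functions on [0, 1], converges almost everywhere;
    the law of the limit is an invariant measure ([list_limit]).  At each stage
    the next errors are chosen so small that the bound on the atoms, and the fact
    that B^m fixes the list for some large m, survive in the limit
    ([limit_generic]). *)

Set Implicit Arguments.
Unset Strict Implicit.
Unset Printing Implicit Defensive.

Import Order.TTheory GRing.Theory Num.Theory.
Import numFieldNormedType.Exports.

Local Open Scope ring_scope.

(** * Orbit sums of a hyperbolic matrix *)

(** The l1 norm is used because sums of norms along orbits and over lists are
    then plain double sums. *)
Definition l1norm (R : numDomainType) d (x : 'cV[R]_d) : R := \sum_i `|x i 0|.

Definition geom (R : pzRingType) d (A : 'M[R]_d) n := \sum_(k < n) A ^+ k.

(** Both factors telescope: |lam - 1| |sum lam^k| = |lam^n - 1| >= ||lam|^n -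
    1|, and the latter is ||lam| - 1| times the sum of the |lam|^k. So the
    constant is uniform in n. *)
Lemma geom_norm_le (F : numFieldType) (lam : F) n : `|lam| != 1 ->
  \sum_(k < n) `|lam| ^+ k <=
  `|lam - 1| / `| `|lam| - 1| * `|\sum_(k < n) lam ^+ k|.
Proof.
move=> lam1; have lam0 : 0 < `| `|lam| - 1| by rewrite normr_gt0 subr_eq0.
rewrite mulrAC ler_pdivlMr// -normrM -subrX1.
have S0 : 0 <= \sum_(k < n) `|lam| ^+ k by apply: sumr_ge0 => k _; rewrite exprn_ge0.
rewrite -{1}(ger0_norm S0) mulrC -normrM -subrX1.
by rewrite -normrX (le_trans _ (ler_dist_dist _ _))// normr1.
Qed.

Lemma mulmx_diag_exp (F : comPzRingType) d (D : 'rV[F]_d) (w : 'cV[F]_d) k i :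
  (diag_mx D ^+ k *m w) i 0 = D 0 i ^+ k * w i 0.
Proof.
elim: k w => [|k IH] w; first by rewrite !expr0 mul1mx mul1r.
by rewrite exprSr -mulmxA IH mul_diag_mx mxE exprSr mulrA.
Qed.

Lemma sum_mulmxl (F : pzRingType) d m n (M : nat -> 'M[F]_d) (v : 'M[F]_(d, m)) :
  (\sum_(k < n) M k) *m v = \sum_(k < n) M k *m v.
Proof. by rewrite mulmx_suml. Qed.

(** In the eigenbasis this is [geom_norm_le] for each coordinate; the change of
    basis costs a constant. *)
Lemma diag_geom_le (F : numFieldType) d (A P : 'M[F]_d) (D : 'rV[F]_d) :
    P \in unitmx -> P *m A = diag_mx D *m P -> (forall j, `|D 0 j| != 1) ->
  exists2 C, 0 <= C & forall n (v : 'cV[F]_d),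
    \sum_(k < n) l1norm (A ^+ k *m v) <= C * l1norm (geom A n *m v).
Proof.
move=> Pu PA D1.
pose c j := `|D 0 j - 1| / `| `|D 0 j| - 1|.
pose C := \sum_i \sum_j `|invmx P i j| * (c j * \sum_l `|P j l|).
have c0 j : 0 <= c j by rewrite divr_ge0.
exists C.
  apply: sumr_ge0 => i _; apply: sumr_ge0 => j _; apply: mulr_ge0 => //.
  by apply: mulr_ge0 => //; apply: sumr_ge0.
move=> n v.
have PAk k (w : 'cV[F]_d) : P *m (A ^+ k *m w) = diag_mx D ^+ k *m (P *m w).
  elim: k w => [|k IH] w; first by rewrite !expr0 !mul1mx.
  by rewrite exprSr -!mulmxA IH [P *m (A *m w)]mulmxA PA exprSr -!mulmxA.
have Pgeom j : (P *m (geom A n *m v)) j 0 = (\sum_(k < n) D 0 j ^+ k) * (P *m v) j 0.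
  rewrite sum_mulmxl mulmx_sumr summxE mulr_suml; apply: eq_bigr => k _.
  by rewrite PAk mulmx_diag_exp.
have wP j : \sum_(k < n) `|D 0 j| ^+ k * `|(P *m v) j 0| <=
    c j * ((\sum_l `|P j l|) * l1norm (geom A n *m v)).
  rewrite -mulr_suml (le_trans (ler_wpM2r _ (geom_norm_le _ _)))// -/(c j) -mulrA.
  rewrite ler_wpM2l// -normrM -Pgeom mxE (le_trans (ler_norm_sum _ _ _))//.
  rewrite mulr_suml ler_sum// => l _; rewrite normrM ler_wpM2l//.
  by rewrite /l1norm (bigD1 l)//= lerDl sumr_ge0.
rewrite [leLHS]exchange_big/= mulr_suml; apply: ler_sum => i _.
apply: (@le_trans _ _ (\sum_(k < n) \sum_j
    `|invmx P i j| * (`|D 0 j| ^+ k * `|(P *m v) j 0|))).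
  apply: ler_sum => k _; rewrite -[A ^+ k *m v](mulKmx Pu) PAk mxE.
  rewrite (le_trans (ler_norm_sum _ _ _))// ler_sum// => j _.
  by rewrite normrM mulmx_diag_exp normrM normrX.
rewrite exchange_big/= mulr_suml; apply: ler_sum => j _.
rewrite -mulr_sumr -!mulrA; apply: ler_wpM2l => //.
by apply: le_trans (wP j) _; rewrite /c !mulrA.
Qed.

Lemma l1norm_complex (R : rcfType) d (x : 'cV[R]_d) :
  l1norm (map_mx (real_complex R) x) = (l1norm x)%:C%C.
Proof.
rewrite /l1norm rmorph_sum/=; apply: eq_bigr => i _.
by rewrite mxE normc_def/= expr0n addr0 sqrtr_sqr.
Qed.

Section Hyperbolic.
Variables (R : rcfType) (d : nat) (A : 'M[int]_d).
Hypothesis A_diag : exists D : 'rV[R[i]%C]_d,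
     map_mx intr A ~_{in unitmx} diag_mx D /\ forall j, `|D 0 j| != 1.
Local Notation AR := (map_mx intr A : 'M[R]_d).

Let A_diagP : exists (P : 'M[R[i]%C]_d) (D : 'rV[R[i]%C]_d), [/\ P \in unitmx,
  P *m map_mx (real_complex R) AR = diag_mx D *m P & forall j, `|D 0 j| != 1].
Proof.
have [D [[P Pu /similarP PA] D1]] := A_diag; exists P, D; split=> //.
rewrite -PA //; congr (_ *m _); apply/matrixP=> i j; rewrite !mxE.
by rewrite rmorph_int.
Qed.

(** The shadowing estimate. A vector v whose geometric sum S_n v is bounded has
    orbit norms whose sum is bounded uniformly in n: the unstable part of v is
    of the size of lam^(-n), the stable part contracts. *)
Lemma orbit_sum_le_geom : exists2 C : R, 0 <= C & forall n (v : 'cV[R]_d),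
    \sum_(k < n) l1norm (AR ^+ k *m v) <= C * l1norm (geom AR n *m v).
Proof.
have [P [D [Pu PA D1]]] := A_diagP.
have [C C0 CP] := diag_geom_le Pu PA D1; exists (complex.Re C) => [|n v].
  by have := C0; rewrite lecE => /andP[].
have CE : C = (complex.Re C)%:C%C by rewrite RRe_real// ger0_real.
have := CP n (map_mx (real_complex R) v); rewrite {}CE.
have -> : geom (map_mx (real_complex R) AR) n *m map_mx (real_complex R) v =
    map_mx (real_complex R) (geom AR n *m v).
  rewrite map_mxM/= /geom raddf_sum/=; congr (_ *m _).
  by apply: eq_bigr => k _; rewrite rmorphXn.
rewrite l1norm_complex -rmorphM/=.
rewrite (eq_bigr (fun k : 'I_n => (l1norm (AR ^+ k *m v))%:C%C)) => [|k _].
  by rewrite -rmorph_sum/= lecR.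
by rewrite -l1norm_complex map_mxM/= rmorphXn.
Qed.

Lemma hyperbolic_fixed0 (v : 'cV[R]_d) : AR *m v = v -> v = 0.
Proof.
have [P [D [Pu PA D1]]] := A_diagP.
pose w := map_mx (real_complex R) v => Av.
have Aw : map_mx (real_complex R) AR *m w = w by rewrite -map_mxM/= Av.
suff w0 : P *m w = 0.
  apply/matrixP => i j; have : w = 0 by rewrite -(mulKmx Pu w) w0 mulmx0.
  by move=> /matrixP/(_ i j); rewrite !mxE => -[].
apply/matrixP => i j; rewrite [j]ord1 [RHS]mxE; apply/eqP.
have := congr1 (fun x : 'cV_d => x i 0) (congr1 (mulmx P) Aw).
rewrite mulmxA PA -mulmxA mul_diag_mx mxE => /eqP.
rewrite -subr_eq0 -{2}[_ i 0]mul1r -mulrBl mulf_eq0 => /orP[]; last by [].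
by rewrite subr_eq0 => /eqP DE; have := D1 i; rewrite DE normr1 eqxx.
Qed.

End Hyperbolic.

(** * Arithmetic of the sums of powers of an integer matrix *)

(** The bound on the period q makes q a divisor of a factorial known
    beforehand. *)
Lemma pigeonhole (T : finType) (f : nat -> T) :
  exists i q, [/\ (0 < q)%N, (q <= #|T|)%N & f i = f (i + q)%N].
Proof.
have /injectivePn[i [j ij fij]] : ~~ injectiveb (fun i : 'I_(#|T|.+1) => f i).
  by apply/injectiveP => /leq_card; rewrite card_ord ltnn.
wlog lt : i j ij fij / (i < j)%N.
  move=> H; case: (ltngtP i j) => [/H|/H|/val_inj E]; first exact.
    by apply=> //; rewrite eq_sym.
  by rewrite E eqxx in ij.
exists i, (j - i)%N; rewrite subn_gt0 lt (subnKC (ltnW lt)); split=> //.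
by have := ltn_ord j; lia.
Qed.

Lemma sum_nat_mul (V : nmodType) (F : nat -> V) L n :
  \sum_(m < L * n) F m = \sum_(i < L) \sum_(k < n) F (i * n + k)%N.
Proof.
elim: L => [|L IH]; first by rewrite !big_ord0.
rewrite big_ord_recr/= -IH mulSnr.
rewrite -(big_mkord xpredT F) (@big_cat_nat _ _ _ (L * n))//= ?leq_addr//.
rewrite big_mkord; congr (_ + _).
by rewrite -{1}[(L * n)%N]add0n big_addn addKn big_mkord; apply: eq_bigr => k _; rewrite addnC.
Qed.

Lemma geom_subr1 (R : pzRingType) d (A : 'M[R]_d) n :
  geom A n *m (A - 1) = A ^+ n - 1.
Proof.
rewrite subrX1; apply/esym; apply: commr_sum => k _.
by apply: commrX; apply: commr_sym; apply: commrB; [|exact: commr1].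
Qed.

Lemma expmxD (R : pzRingType) d (A : 'M[R]_d) m n :
  A ^+ (m + n) = A ^+ m *m A ^+ n.
Proof. exact: exprD. Qed.

(** If a prime p divides m and det S_n, some v over F_p satisfies v S_n = 0,
    hence v A^n = v, so v is A-periodic; its period is at most p^d and divides
    (m^d)!. The terms v A^k with 0 < k < n then form m t equal blocks, which
    cancel modulo p, so that v S_n = v, whereas v S_n = 0. *)
Lemma coprime_det_geom d (A : 'M[int]_d) (m n t : nat) :
    (0 < m)%N -> n = (m * (m ^ d)`! * t).+1 ->
  coprime `|\det (geom A n)|%N m.
Proof.
move=> m0 nE; apply/negPn/negP => ncop.
have /pdivP[p pp] : (1 < gcdn `|\det (geom A n)| m)%N.
  by move: ncop (gcdn_gt0 `|\det (geom A n)|%N m); rewrite /coprime; lia.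
rewrite dvdn_gcd => /andP[pdet pm].
pose Ap : 'M['F_p]_d := map_mx intr A.
have det0 : \det (geom Ap n) = 0.
  have -> : geom Ap n = map_mx intr (geom A n).
    by rewrite /geom raddf_sum/=; apply: eq_bigr => k _; rewrite rmorphXn.
  rewrite det_map_mx [\det _]intEsign rmorphM/= -pmulrn.
  suff -> : `|\det (geom A n)|%N%:R = 0 :> 'F_p by rewrite mulr0.
  by apply/eqP; rewrite -(dvdn_pcharf (pchar_Fp pp)).
have /det0P[v v0 vS] : \det (geom Ap n) == 0 by rewrite det0.
have vAn : v *m Ap ^+ n = v.
  have := congr1 (mulmxr (Ap - 1)) vS.
  by rewrite /= mul0mx -mulmxA geom_subr1 mulmxBr mulmx1 => /eqP; rewrite subr_eq0 => /eqP.
have vAnk k : v *m Ap ^+ (n * k) = v.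
  by elim: k => [|k IH]; [rewrite muln0 expr0 mulmx1|rewrite mulnS expmxD mulmxA vAn].
have [i [q [q0 qle viq]]] := pigeonhole (fun k => v *m Ap ^+ k).
(* The preperiod i is removed by n i - i further steps, as v A^(n i) = v. *)
have vAq : v *m Ap ^+ q = v.
  have := congr1 (mulmxr (Ap ^+ (n * i - i))) viq.
  rewrite /= -!mulmxA -!expmxD addnAC subnKC; last by rewrite nE leq_pmull.
  by rewrite expmxD mulmxA !vAnk.
have {qle q0} qdvd : (q %| (m ^ d)`!)%N.
  rewrite dvdn_fact// q0/= (leq_trans qle)// card_mx card_Fp// mul1n.
  by case: (posnP d) => [->|d0]; rewrite ?expn0// leq_exp2r// dvdn_leq.
have vAs k : v *m Ap ^+ (k + (m ^ d)`!) = v *m Ap ^+ k.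
  rewrite addnC expmxD mulmxA; congr (_ *m _); have /dvdnP[c ->] := qdvd.
  by rewrite mulnC exprM; elim: c => [|c IH]; rewrite ?expr0 ?mulmx1// exprS mulmxA vAq.
have : v *m geom Ap n = v.
  rewrite /geom nE big_ord_recl expr0 mulmxDr mulmx1 -[RHS]addr0; congr (_ + _).
  rewrite mulmx_sumr mulnAC.
  rewrite (sum_nat_mul (fun k => v *m Ap ^+ k.+1) (m * t) (m ^ d)`!).
  have vAs' k j : v *m Ap ^+ (j * (m ^ d)`! + k) = v *m Ap ^+ k.
    by elim: j => [//|j IH]; rewrite mulSnr addnAC vAs IH.
  under eq_bigr do under eq_bigr do rewrite -addnS vAs'.
  rewrite sumr_const card_ord -scaler_nat.
  suff -> : (m * t)%N%:R = 0 :> 'F_p by rewrite scale0r.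
  by apply/eqP; rewrite -(dvdn_pcharf (pchar_Fp pp)) dvdn_mulr.
by rewrite vS => v0'; rewrite -v0' eqxx in v0.
Qed.

(** A modulus m > 1 excludes det S_n = 0, since gcd(0, m) = m. *)
Lemma det_geom_unit (F : realFieldType) d (A : 'M[int]_d) m n :
    (1 < m)%N -> coprime `|\det (geom A n)|%N m ->
  geom (map_mx intr A : 'M[F]_d) n \in unitmx.
Proof.
move=> m1 cop; have -> : geom (map_mx intr A : 'M[F]_d) n = map_mx intr (geom A n).
  by rewrite /geom raddf_sum/=; apply: eq_bigr => k _; rewrite rmorphXn.
rewrite unitmxE det_map_mx unitfE intr_eq0; apply: contraTneq cop => ->.
by rewrite /coprime gcd0n; lia.
Qed.

(** Some power B^i agrees with B^(i + q) modulo u; multiplying by the adjugate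
    of B^i replaces B^i by a power of det B, which is prime to u and can be
    cancelled. *)
Lemma exp_mod_coprime d (B : 'M[int]_d) (u : nat) : (0 < u)%N ->
    coprime u `|\det B|%N ->
  exists2 q, (0 < q)%N & exists C : 'M[int]_d, B ^+ q = 1 + u%:Z *: C.
Proof.
move=> u0 cop.
pose f k : {ffun 'I_d * 'I_d -> 'I_u} :=
  [ffun ij => Ordinal (ltn_pmod `|((B ^+ k) ij.1 ij.2 %% u)%Z|%N u0)].
have [i [q [q0 _ /ffunP fE]]] := pigeonhole f; exists q => //.
have uBB k l : (u%:Z %| (B ^+ i * (B ^+ q - 1))%R k l)%Z.
  have /(congr1 val)/= := fE (k, l); rewrite !ffunE/=.
  have u0' : u%:Z != 0 by lia.
  rewrite !modn_small; try by rewrite -ltz_nat gez0_abs ?modz_ge0// ltz_pmod//; lia.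
  move=> /(congr1 Posz); rewrite !gez0_abs ?modz_ge0// => /eqP.
  by rewrite eq_sym eqz_mod_dvd mulrBr mulr1 -exprD !mxE.
have uB k l : (u%:Z %| (B ^+ q - 1)%R k l)%Z.
  have : (u%:Z %| ((\adj (B ^+ i) *m (B ^+ i *m (B ^+ q - 1))) : 'M[int]_d) k l)%Z.
    by rewrite mxE; apply: rpred_sum => j _; rewrite dvdz_mull// uBB.
  rewrite mulmxA mul_adj_mx mul_scalar_mx mxE Gauss_dvdzr//.
  have -> : \det (B ^+ i) = \det B ^+ i.
    by elim: (i) => [|j IH]; rewrite ?expr0 ?det1// !exprS det_mulmx IH.
  by rewrite coprimezE abszX coprimeXr.
exists (\matrix_(k, l) ((B ^+ q - 1)%R k l %/ u)%Z).
apply/eqP; rewrite addrC -subr_eq; apply/eqP/matrixP => k l.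
by rewrite [RHS]mxE [in RHS]mxE mulrC divzK.
Qed.

(** * Shadowing by periodic rational points *)

Lemma l1norm_ge0 (R : numDomainType) d (x : 'cV[R]_d) : 0 <= l1norm x.
Proof. by apply: sumr_ge0. Qed.

Lemma l1normN (R : numDomainType) d (x : 'cV[R]_d) : l1norm (- x) = l1norm x.
Proof. by apply: eq_bigr => i _; rewrite mxE normrN. Qed.

Lemma l1norm0 (R : numDomainType) d : l1norm (0 : 'cV[R]_d) = 0.
Proof. by apply: big1 => i _; rewrite mxE normr0. Qed.

Lemma ler_l1normD (R : numDomainType) d (x y : 'cV[R]_d) :
  l1norm (x + y) <= l1norm x + l1norm y.
Proof.
by rewrite -big_split/=; apply: ler_sum => i _; rewrite mxE ler_normD.
Qed.

Lemma ler_coord_l1norm (R : numDomainType) d (x : 'cV[R]_d) i : `|x i 0| <= l1norm x.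
Proof. by rewrite /l1norm (bigD1 i)//= lerDl sumr_ge0. Qed.

Lemma l1norm_eq0 (R : numDomainType) d (x : 'cV[R]_d) : l1norm x = 0 -> x = 0.
Proof.
move=> x0; apply/matrixP => i j; rewrite [j]ord1 mxE; apply/eqP.
by rewrite -normr_le0 -x0 ler_coord_l1norm.
Qed.

Lemma l1norm_int_ge1 (R : archiRealDomainType) d (x : 'cV[R]_d) :
  x \is a mxOver Num.int -> x != 0 -> 1 <= l1norm x.
Proof.
move=> /mxOverP xint x0; have [i xi0] : exists i, x i 0 != 0.
  apply/existsP; rewrite -negb_forall; apply: contra x0 => /forallP x0.
  by apply/eqP/matrixP => i j; rewrite [j]ord1 mxE (eqP (x0 i)).
by apply: le_trans (ler_coord_l1norm x i); exact: norm_intr_ge1.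
Qed.

Lemma mxOver_int_mul (R : archiRealDomainType) d m (M : 'M[int]_d) (x : 'M[R]_(d, m)) :
  x \is a mxOver Num.int -> map_mx intr M *m x \is a mxOver Num.int.
Proof.
move=> xint; apply: mxOverM => //; apply/mxOverP => i j.
by rewrite mxE intr_int.
Qed.

Lemma mxOver_intD (R : archiRealDomainType) m n (x y : 'M[R]_(m, n)) :
  x \is a mxOver Num.int -> y \is a mxOver Num.int -> x + y \is a mxOver Num.int.
Proof. by move=> /mxOverP xi /mxOverP yi; apply/mxOverP => i j; rewrite mxE rpredD. Qed.

Lemma mxOver_intB (R : archiRealDomainType) m n (x y : 'M[R]_(m, n)) :
  x \is a mxOver Num.int -> y \is a mxOver Num.int -> x - y \is a mxOver Num.int.
Proof. by move=> /mxOverP xi /mxOverP yi; apply/mxOverP => i j; rewrite !mxE rpredB. Qed.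

Lemma mxOver_intN (R : archiRealDomainType) m n (x : 'M[R]_(m, n)) :
  x \is a mxOver Num.int -> - x \is a mxOver Num.int.
Proof. by move=> /mxOverP xi; apply/mxOverP => i j; rewrite !mxE rpredN. Qed.

Section Torus.
Variables (R : realType) (d : nat).
Implicit Types (x y : 'cV[R]_d) (M : 'M[int]_d).

Lemma map_mxX_intr M k : (map_mx intr (M ^+ k) : 'M[R]_d) = map_mx intr M ^+ k.
Proof. by rewrite rmorphXn. Qed.

Lemma iter_toral_endo M k x :
  iter k (toral_endo M) (torus_proj x) = torus_proj (map_mx intr M ^+ k *m x).
Proof.
elim: k => [|k IH]; first by rewrite expr0 mul1mx.
by rewrite iterS IH toral_endo_proj mulmxA exprS.
Qed.

Lemma torus_projDint x v : v \is a mxOver Num.int ->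
  torus_proj (x + v) = torus_proj x.
Proof. by move=> vint; apply/torus_projP; rewrite addrC addKr. Qed.

Definition floor_vec x : 'cV[R]_d := \col_i (Num.floor (x i 0))%:~R.

Lemma floor_vec_int x : floor_vec x \is a mxOver Num.int.
Proof. by apply/mxOverP => i j; rewrite mxE intr_int. Qed.

Lemma floor_vec_le x i : 0 <= (x - floor_vec x) i 0 < 1.
Proof.
have /andP[le lt] := floor_itv (x i 0).
by rewrite !mxE subr_ge0 ltrBlDl le/= -[1]/(1%:~R) -intrD.
Qed.

Lemma l1norm_floor_vec x : l1norm (floor_vec x - x) <= d%:R.
Proof.
rewrite -l1normN opprB -[d in d%:R]card_ord -sumr_const; apply: ler_sum => i _.
by have /andP[? /ltW] := floor_vec_le x i; rewrite ger0_norm.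
Qed.

End Torus.

Section Shadowing.
Variables (R : realType) (d : nat) (A : 'M[int]_d).
Hypothesis d0 : (0 < d)%N.
Hypothesis detA : \det A != 0.
Hypothesis A_diag : exists D : 'rV[R[i]%C]_d,
     map_mx intr A ~_{in unitmx} diag_mx D /\ forall j, `|D 0 j| != 1.
Local Notation AR := (map_mx intr A : 'M[R]_d).

Lemma map_intr_unit : AR \in unitmx.
Proof. by rewrite unitmxE det_map_mx unitfE intr_eq0. Qed.

Lemma map_intr_exp_unit k : AR ^+ k \in unitmx.
Proof.
by elim: k => [|k IH]; rewrite ?expr0 ?unitmx1// exprS unitmx_mul map_intr_unit.
Qed.

(** The point y is the solution of S_n y = z for an integer vector z near S_n
    x. If y is fixed by A on the torus, z is replaced by z + e_1: were both
    choices fixed, then w = (A - 1) S_n^-1 e_1 would be a nonzero integer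
    vector, so each A^k w with k < n would have norm at least 1, whereas the
    sum of these norms is bounded independently of n. That y is not fixed is
    what later spreads its orbit over many points. *)
Lemma shadowing : exists C N0, forall n m, (1 < m)%N ->
    coprime `|\det (geom A n)|%N m -> (N0 <= n)%N ->
  forall x : 'cV[R]_d, exists y : 'cV[R]_d,
    [/\ (`|\det (geom A n)|%N%:R *: y) \is a mxOver Num.int,
        torus_proj (AR ^+ n *m y) = torus_proj y,
        torus_proj (AR *m y) <> torus_proj y &
        \sum_(k < n) l1norm (AR ^+ k *m (y - x)) <= C].
Proof.
have [C C0 CP] := orbit_sum_le_geom A_diag.
pose e1 : 'cV[R]_d := delta_mx (Ordinal d0) 0.
have e1int : e1 \is a mxOver Num.int.
  by apply/mxOverP => i j; rewrite mxE natr_int.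
have l1e1 : l1norm e1 = 1.
  rewrite /l1norm (bigD1 (Ordinal d0))//= big1 ?addr0 => [|i /negPf ni].
    by rewrite mxE !eqxx normr1.
  by rewrite mxE ni normr0.
pose C' := C * l1norm ((AR - 1) *m e1).
(* Rounding costs at most d in l1 norm and adding e_1 costs 1 more; beyond C'
   iterates, w below cannot have all its orbit norms at least 1. *)
exists (C * (d%:R + 1)), (Num.trunc C').+1 => n m m1 cop nN x.
have Su := det_geom_unit R m1 cop; set S := geom AR n in Su.
have SE : S = map_mx intr (geom A n).
  by rewrite /S /geom raddf_sum/=; apply: eq_bigr => k _; rewrite rmorphXn.
have AS : (AR - 1) *m S = AR ^+ n - 1 by rewrite subrX1.
have SA : S *m (AR - 1) = AR ^+ n - 1 by exact: geom_subr1.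
have periodic z : z \is a mxOver Num.int ->
    torus_proj (AR ^+ n *m (invmx S *m z)) = torus_proj (invmx S *m z).
  move=> zint; apply/torus_projP; rewrite -[X in _ - X]mul1mx -mulmxBl -AS.
  by rewrite mulmxA mulmxK// mulmxBl mul1mx mxOver_intB// mxOver_int_mul.
have denom z : z \is a mxOver Num.int ->
    (`|\det (geom A n)|%N%:R *: (invmx S *m z)) \is a mxOver Num.int.
  move=> zint; rewrite scalemxAl /invmx Su scalerA.
  have -> : \adj S = map_mx intr (\adj (geom A n)) by rewrite SE map_mx_adj.
  have -> : `|\det (geom A n)|%N%:R / \det S = ((-1) ^+ (\det (geom A n) < 0)%R)%:~R :> R.
    have S0 : \det S != 0 by rewrite -unitfE -unitmxE.
    apply: (mulIf S0); rewrite divfK// SE det_map_mx -intrM.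
    by rewrite [X in _ * X]intEsign mulrA -expr2 sqrr_sign mul1r -pmulrn.
  by rewrite -scalemxAl; apply: mxOverZ; rewrite ?intr_int ?mxOver_int_mul.
have near_x : forall z, l1norm (z - S *m x) <= d%:R + 1 ->
    \sum_(k < n) l1norm (AR ^+ k *m (invmx S *m z - x)) <= C * (d%:R + 1).
  move=> z zx; apply: le_trans (CP _ _) _; rewrite ler_wpM2l//.
  by rewrite mulmxBr mulKVmx.
pose z0 := floor_vec (S *m x); pose z1 := z0 + e1.
have z0int : z0 \is a mxOver Num.int by exact: floor_vec_int.
have z1int : z1 \is a mxOver Num.int := mxOver_intD z0int e1int.
have z0x : l1norm (z0 - S *m x) <= d%:R by exact: l1norm_floor_vec.
have [fix0|nfix0] := pselect
  (torus_proj (AR *m (invmx S *m z0)) = torus_proj (invmx S *m z0)); last first.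
  exists (invmx S *m z0); split; [exact: denom|exact: periodic|exact: nfix0|].
  by apply: near_x; rewrite ler_wpDr.
exists (invmx S *m z1); split; [exact: denom|exact: periodic| |]; last first.
  apply: near_x; rewrite addrAC (le_trans (ler_l1normD _ _))// l1e1.
  by rewrite lerD2r.
move=> fix1; pose w := (AR - 1) *m (invmx S *m e1).
have wint : w \is a mxOver Num.int.
  rewrite /w [e1](_ : _ = z1 - z0); last by rewrite addrC addKr.
  move: fix0 fix1 => /torus_projP fix0 /torus_projP fix1.
  by rewrite !mulmxBr !mulmxBl !mul1mx mxOver_intB.
have w0 : w != 0.
  apply/eqP; rewrite /w mulmxBl mul1mx => /eqP; rewrite subr_eq0 => /eqP.
  move=> /(hyperbolic_fixed0 A_diag) /(congr1 (mulmx S)).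
  by rewrite mulKVmx// mulmx0 => e10; move: l1e1;
    rewrite e10 l1norm0 => /eqP; rewrite eq_sym oner_eq0.
have : n%:R <= C'.
  rewrite [leRHS](_ : _ = C * l1norm (S *m w)); last first.
    by rewrite /C' /w mulmxA SA -AS -!mulmxA mulKVmx.
  apply: le_trans (CP _ _); rewrite -[n in n%:R]card_ord -sumr_const.
  apply: ler_sum => k _; apply: l1norm_int_ge1.
    by rewrite -map_mxX_intr mxOver_int_mul.
  have Aku : AR ^+ k \in unitmx by exact: map_intr_exp_unit.
  by apply: contra w0 => /eqP Aw; rewrite -(mulKmx Aku w) Aw mulmx0.
rewrite leNgt => /negP; apply; apply: lt_le_trans (truncnS_gt _) _.
by rewrite ler_nat.
Qed.

End Shadowing.

(** * Invariant lists of rational points *)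

Lemma sum_exclusive_le1 n (b : nat -> bool) :
  (forall i j, (i < j < n)%N -> b i -> b j -> False) -> (\sum_(k < n) b k <= 1)%N.
Proof.
move=> excl; have [[k bk]|nb] := pselect (exists k : 'I_n, b k); last first.
  by rewrite big1// => k _; apply/eqP; rewrite eqb0; apply/negP => bk; apply: nb; exists k.
rewrite (bigD1 k)//= bk big1// => j jk; apply/eqP; rewrite eqb0; apply/negP => bj.
have [lt|lt|/val_inj E] := ltngtP (val j) (val k); last by rewrite E eqxx in jk.
  by apply: excl bj bk; rewrite lt /=.
by apply: excl bk bj; rewrite lt /=.
Qed.

Lemma iter_fix (T : Type) (f : T -> T) p q c : iter q f p = p -> iter (c * q) f p = p.
Proof. by move=> fp; elim: c => [//|c IH]; rewrite mulSn iterD IH. Qed.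

(** Every q <= D divides D!, hence n - 1. If f^q p = p with 0 < q <= D, then
    f^(n-1) p = p, and f^n p = p forces f p = p. So two visits to w are more
    than D steps apart. *)
Lemma orbit_hits_le (T : eqType) (f : T -> T) p n D t w :
    n = (D`! * t).+1 -> iter n f p = p -> f p <> p ->
  ((\sum_(k < n) (iter k f p == w)) * D <= n + D)%N.
Proof.
move=> nE fn fp; have [->|D0] := posnP D; first by rewrite muln0.
have far q : (0 < q <= D)%N -> iter q f p <> p.
  move=> /andP[q0 qD] fq; apply: fp; rewrite -{2}fn nE iterS; congr f.
  have /dvdnP[c ->] : (q %| D`! * t)%N by rewrite dvdn_mulr// dvdn_fact// q0.
  by rewrite iter_fix.
have excl i j : (i < j < n)%N -> (j - i <= D)%N ->
    iter i f p == w -> iter j f p == w -> False.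
  move=> /andP[ij jn] jiD /eqP <- /eqP; rewrite -[in LHS](subnK (ltnW ij)) addnC.
  move=> /(congr1 (iter (n - i) f)); rewrite -!iterD addnA subnK; last by lia.
  by rewrite addnC iterD fn; apply: far; lia.
have /dvdnP[c cE] : (D %| D`! * t)%N by rewrite dvdn_mulr// dvdn_fact// D0 leqnn.
rewrite nE cE big_ord_recl mulnDl addnC.
have -> : (\sum_(i < c * D) (iter (lift ord0 i) f p == w) =
  \sum_(i < c) \sum_(k < D) (iter (i * D + k).+1 f p == w))%N.
  exact: (sum_nat_mul (fun k => (iter k.+1 f p == w) : nat)).
apply: leq_add; last by rewrite -[leqRHS]mul1n leq_mul2r leq_b1 orbT.
rewrite ltnW// ltnS leq_mul2r; apply/orP; right; rewrite -[leqRHS]card_ord -sum1_card.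
apply: leq_sum => i _; apply: (@sum_exclusive_le1 _ (fun k => iter (i * D + k).+1 f p == w)).
move=> k l /andP[kl lD]; apply: excl; last by lia.
rewrite !ltnS ltn_add2l kl/= nE cE ltnS.
by have := ltn_ord i; nia.
Qed.

Section Lists.
Variables (R : realType) (d : nat) (A B : 'M[int]_d).
Local Notation AR := (map_mx intr A : 'M[R]_d).
Local Notation T := (toral_endo A : torus R d -> torus R d).

(** The uniform measure on the list s(0), ..., s(L - 1) of lifts to R^d of
    torus points. The last clause says that this measure is A-invariant; the
    clauses on u put the points in (1/u) Z^d with u prime to det B, which makes
    them B-periodic. *)
Definition good_list (L : nat) (s : nat -> 'cV[R]_d) (u : nat) :=
  [/\ (0 < L)%N, (0 < u)%N, coprime u `|\det B|%N,
      forall i, (i < L)%N -> (u%:R *: s i) \is a mxOver Num.int &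
      forall h : torus R d -> R,
        \sum_(i < L) h (T (torus_proj (s i))) = \sum_(i < L) h (torus_proj (s i))].

Lemma divmod_block n i k : (k < n)%N -> ((i * n + k) %/ n = i)%N /\ ((i * n + k) %% n = k)%N.
Proof.
move=> kn; have n0 : (0 < n)%N by lia.
by rewrite divnMDl// modnMDl divn_small// modn_small// addn0.
Qed.

(** An invariant list agrees with its image as a multiset, so A permutes its
    indices. *)
Lemma invariant_perm L (p : 'I_L -> torus R d) :
    (forall h : torus R d -> R, \sum_(i < L) h (T (p i)) = \sum_(i < L) h (p i)) ->
  exists rho : {perm 'I_L}, forall i, T (p (rho i)) = p i.
Proof.
move=> inv; have : perm_eq [tuple p i | i < L] [tuple T (p i) | i < L].
  apply/allP => w _ /=; apply/eqP; rewrite !count_map.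
  have cE (q : 'I_L -> torus R d) :
      (count (preim q (pred1 w)) (Finite.enum 'I_L))%:R = \sum_(i < L) (q i == w)%:R :> R.
    by rewrite -enumT -natr_sum -sum1_count big_mkcond/= big_enum.
  apply/eqP; rewrite -(eqr_nat R); apply/eqP/(etrans (cE p))/esym.
  exact: etrans (cE (fun i => T (p i))) (inv (fun x => (x == w)%:R)).
move=> /tuple_permP[rho rhoE]; exists rho => i; apply/esym.
have := congr1 (fun t => nth (p i) t i) rhoE.
have lti := ltn_ord i.
by rewrite -!tnth_nth !tnth_mktuple.
Qed.

(** The list consists of full periodic orbits: position i n + k holds the k-th
    iterate of y (rho_k i), up to an integer vector. The permutations rho_k
    serve to place next to each other points which are close. *)
Lemma good_list_orbits L n u (y : 'I_L -> 'cV[R]_d) (rho : nat -> {perm 'I_L})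
    (s : nat -> 'cV[R]_d) :
    (0 < L)%N -> (0 < n)%N -> (0 < u)%N -> coprime u `|\det B|%N ->
    (forall i, (u%:R *: y i) \is a mxOver Num.int) ->
    (forall i, torus_proj (AR ^+ n *m y i) = torus_proj (y i)) ->
    (forall (i : 'I_L) k, (k < n)%N ->
      s (i * n + k)%N - AR ^+ k *m y (rho k i) \is a mxOver Num.int) ->
  good_list (L * n) s u.
Proof.
move=> L0 n0 u0 uB uy yn sE.
have psE (i : 'I_L) k : (k < n)%N ->
    torus_proj (s (i * n + k)%N) = iter k T (torus_proj (y (rho k i))).
  by move=> kn; rewrite iter_toral_endo; apply/torus_projP; exact: sE.
split=> //; first by rewrite muln_gt0 L0.
  move=> m mlt.
  have mn : (m %/ n < L)%N by rewrite ltn_divLR.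
  have := sE (Ordinal mn) (m %% n)%N (ltn_pmod _ n0); rewrite /= -divn_eq => sm.
  rewrite -[s m](subrK (AR ^+ (m %% n) *m y (rho (m %% n)%N (Ordinal mn)))).
  rewrite scalerDr mxOver_intD//; first by rewrite mxOverZ// natr_int.
  by rewrite scalemxAr -map_mxX_intr mxOver_int_mul.
move=> h.
rewrite (sum_nat_mul (fun m => h (T (torus_proj (s m))))).
rewrite (sum_nat_mul (fun m => h (torus_proj (s m)))).
rewrite exchange_big/= [RHS]exchange_big/=.
have reindex (g : nat -> torus R d -> R) :
    \sum_(k < n) \sum_(i < L) g k (torus_proj (y (rho k i))) =
    \sum_(i < L) \sum_(k < n) g k (torus_proj (y i)).
  rewrite [RHS]exchange_big/=; apply: eq_bigr => k _.
  by rewrite [RHS](reindex_inj (@perm_inj _ (rho k))).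
under eq_bigr => k _ do under eq_bigr => i _ do rewrite psE//.
under [RHS]eq_bigr => k _ do under eq_bigr => i _ do rewrite psE//.
rewrite (reindex (fun k x => h (T (iter k T x)))) (reindex (fun k x => h (iter k T x))).
apply: eq_bigr => i _; move: (yn i); rewrite -iter_toral_endo.
case: (n) => [|n']; first by rewrite !big_ord0.
move=> yn'; rewrite big_ord_recr [RHS]big_ord_recl/=.
by move: yn'; rewrite /= => ->; rewrite addrC.
Qed.

Hypothesis detB : \det B != 0.

(** On the finite group (1/u) Z^d / Z^d some power B^q is the identity; so are
    its powers. *)
Lemma good_list_recurrent L s u : good_list L s u ->
  forall N, exists2 m, (N <= m)%N & forall i, (i < L)%N ->
    toral_endo (B ^+ m) (torus_proj (s i)) = torus_proj (s i).
Proof.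
move=> [_ u0 uB us _] N.
have [q q0 [C BqC]] := exp_mod_coprime u0 uB.
exists (q * N)%N => [|i iL]; first by rewrite leq_pmull.
have fixq : toral_endo (B ^+ q) (torus_proj (s i)) = torus_proj (s i).
  rewrite toral_endo_proj BqC; apply/torus_projP.
  rewrite map_mxD map_mx1 map_mxZ/= mulmxDl mul1mx addrC addKr -scalemxAl scalemxAr.
  by rewrite mxOver_int_mul// us.
elim: N => [|N IH]; first by rewrite muln0 expr0 toral_endo_proj map_mx1 mul1mx.
by rewrite mulnS exprD toral_endo_proj map_mxM/= -mulmxA -toral_endo_proj -toral_endo_proj IH fixq.
Qed.

Hypothesis d0 : (0 < d)%N.
Hypothesis detA : \det A != 0.
Hypothesis A_diag : exists D : 'rV[R[i]%C]_d,
     map_mx intr A ~_{in unitmx} diag_mx D /\ forall j, `|D 0 j| != 1.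

(** The integer u is |det S_n|. The factor D! in n - 1 serves [orbit_hits_le],
    the others serve [coprime_det_geom]. *)
Lemma shadowing_scales : exists C : R, forall D N, exists n u, [/\ (N <= n)%N, (0 < u)%N,
   coprime u `|\det B|%N, exists t, n = (D`! * t).+1 &
  forall x : 'cV[R]_d, exists y : 'cV[R]_d,
    [/\ (u%:R *: y) \is a mxOver Num.int,
        torus_proj (AR ^+ n *m y) = torus_proj y,
        torus_proj (AR *m y) <> torus_proj y &
        \sum_(k < n) l1norm (AR ^+ k *m (y - x)) <= C]].
Proof.
have [C [N0 shadow]] := shadowing d0 detA A_diag; exists C => D N.
pose m := (2 * `|\det B|)%N.
have m1 : (1 < m)%N by rewrite /m; lia.
(* The factor N + N0 only makes n large. *)
pose t := (D`! * (N + N0))%N; pose n := (m * (m ^ d)`! * t).+1.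
have cop : coprime `|\det (geom A n)| m by apply: coprime_det_geom (erefl n); lia.
have nle : (N + N0 <= n)%N.
  by rewrite /n /t mulnA (leq_trans _ (leqnSn _))// leq_pmull// !muln_gt0 !fact_gt0 andbT; lia.
exists n, `|\det (geom A n)|%N; split=> //; first by lia.
- by apply: contraTT cop; rewrite -eqn0Ngt => /eqP ->; rewrite /coprime gcd0n; lia.
- by move: cop; rewrite coprimeMr => /andP[].
- by exists (m * (m ^ d)`! * (N + N0))%N; rewrite /n /t; congr S; lia.
- by apply: (shadow n m) => //; lia.
Qed.

End Lists.

Section Refine.
Variables (R : realType) (d : nat) (A B : 'M[int]_d).
Local Notation AR := (map_mx intr A : 'M[R]_d).
Local Notation T := (toral_endo A : torus R d -> torus R d).
Hypothesis d0 : (0 < d)%N.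
Hypothesis detA : \det A != 0.
Hypothesis detB : \det B != 0.
Hypothesis A_diag : exists D : 'rV[R[i]%C]_d,
     map_mx intr A ~_{in unitmx} diag_mx D /\ forall j, `|D 0 j| != 1.

(** Let rho be the permutation with A s(rho i) = s(i) on the torus. If y(j)
    shadows s(j), then A^k y(rho^k i) is close to A^k s(rho^k i) = s(i);
    translated by an integer vector it becomes the k-th entry of the block that
    replaces s(i). For fixed k, the index rho^k i runs over all indices, so the
    total displacement is that of all shadowed orbits. *)
Lemma good_list_refine L s u (eta : R) D : @good_list R d A B L s u -> 0 < eta ->
  exists n s' u', [/\ (0 < n)%N, @good_list R d A B (L * n) s' u',
    \sum_(m < L * n) l1norm (s' m - s (m %/ n)%N) <= eta * (L * n)%:R &
    forall w, ((\sum_(m < L * n) (torus_proj (s' m) == w)) * D <= L * n)%N].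
Proof.
move=> [L0 _ _ _ inv] eta0.
have [C shadow] := shadowing_scales detB d0 detA A_diag.
(* A point is hit at most (n + 2 D) / (2 D) times by each orbit, hence at most n / D
   times since n >= 2 D. *)
have [n [u' [nN u'0 u'B [t nt]]]] :=
  shadow (2 * D)%N (2 * D + (Num.trunc (C / eta)).+1)%N.
move=> /(_ (s _)) y_; have /choice[y yP] := fun i : 'I_L => y_ i => {y_}.
have n0 : (0 < n)%N by rewrite nt.
have [rho rhoE] := @invariant_perm R d A L (fun i => torus_proj (s i)) inv.
have rhokE k (i : 'I_L) : AR ^+ k *m s ((rho ^+ k)%g i) - s i \is a mxOver Num.int.
  apply/torus_projP; rewrite -iter_toral_endo; elim: k => [|k IH].
    by rewrite expg0 perm1.
  by rewrite iterSr expgSr permM rhoE IH.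
pose s' m : 'cV[R]_d := if insub (m %/ n)%N is Some i then
  AR ^+ (m %% n) *m (y ((rho ^+ (m %% n))%g i) - s ((rho ^+ (m %% n))%g i)) + s i else 0.
have s'E (i : 'I_L) k : (k < n)%N -> s' (i * n + k)%N =
    AR ^+ k *m (y ((rho ^+ k)%g i) - s ((rho ^+ k)%g i)) + s i.
  by move=> kn; rewrite /s'; have [-> ->] := divmod_block i kn; rewrite valK.
have s'y (i : 'I_L) k : (k < n)%N ->
    s' (i * n + k)%N - AR ^+ k *m y ((rho ^+ k)%g i) \is a mxOver Num.int.
  move=> kn; rewrite s'E// mulmxBr.
  set a := _ *m _; set b := _ *m _.
  have -> : a - b + s i - a = - (b - s i) by rewrite opprB -addrA addrC addrA subrK.
  exact/mxOver_intN/rhokE.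
exists n, s', u'; split=> //.
- apply: (good_list_orbits L0 n0 u'0 u'B _ _ s'y) => i; first by case: (yP i).
  by have [] := yP i.
- rewrite (sum_nat_mul (fun m => l1norm (s' m - s (m %/ n)%N))).
  rewrite (eq_bigr (fun i : 'I_L => \sum_(k < n)
    l1norm (AR ^+ k *m (y ((rho ^+ k)%g i) - s ((rho ^+ k)%g i))))); last first.
    move=> i _; apply: eq_bigr => k _; have [-> _] := divmod_block i (ltn_ord k).
    by rewrite s'E// addrK.
  rewrite exchange_big/=.
  rewrite (eq_bigr (fun k : 'I_n =>
    \sum_(i < L) l1norm (AR ^+ k *m (y i - s i)))); last first.
    by move=> k _; rewrite [RHS](reindex_inj (@perm_inj _ (rho ^+ k)%g)).
  rewrite exchange_big/= (@le_trans _ _ (\sum_(i < L) C))//.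
    by apply: ler_sum => i _; case: (yP i).
  rewrite sumr_const card_ord -[_ *+ _]mulr_natl natrM mulrCA ler_wpM2l//.
  rewrite mulrC -ler_pdivrMr// ltW// (lt_le_trans (truncnS_gt _))// ler_nat.
  exact: leq_trans (leq_addl _ _) nN.
- move=> w.
  have -> : (\sum_(m < L * n) (torus_proj (s' m) == w) =
      \sum_(i < L) \sum_(k < n) (iter k T (torus_proj (y i)) == w))%N.
    rewrite (sum_nat_mul (fun m => (torus_proj (s' m) == w) : nat)).
    rewrite exchange_big [RHS]exchange_big/=; apply: eq_bigr => k _.
    rewrite [RHS](reindex_inj (@perm_inj _ (rho ^+ k)%g))/=; apply: eq_bigr => i _.
    rewrite iter_toral_endo; congr (nat_of_bool (_ == _)).
    by apply/torus_projP; exact: s'y.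
  rewrite big_distrl/= -[L in leqRHS]card_ord -sum_nat_const; apply: leq_sum => i _.
  have [_ yn y1 _] := yP i.
  rewrite -iter_toral_endo in yn; rewrite -toral_endo_proj in y1.
  have := orbit_hits_le w nt yn y1.
  by set X := (\sum_(k < n) _)%N; nia.
Qed.

(** The scale n is chosen before the points x, so that a mean over n iterates
    can first be approximated by a mean over finitely many x. *)
Lemma good_list_near (eta : R) : 0 < eta ->
  exists2 n, (0 < n)%N & forall N (x : nat -> 'cV[R]_d), (0 < N)%N -> exists s u,
    @good_list R d A B (N * n) s u /\
    \sum_(m < N * n) l1norm (s m - AR ^+ (m %% n) *m x (m %/ n)%N) <= eta * (N * n)%:R.
Proof.
move=> eta0.
have [C shadow] := shadowing_scales detB d0 detA A_diag.
have [n [u' [nN u'0 u'B [t nt]]]] := shadow 0%N (Num.trunc (C / eta)).+1.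
move=> /choice[y yP].
have n0 : (0 < n)%N by rewrite nt.
exists n => // N x N0; pose s m := AR ^+ (m %% n) *m y (x (m %/ n)%N).
have sE i k : (k < n)%N -> s (i * n + k)%N = AR ^+ k *m y (x i).
  by move=> kn; rewrite /s; have [-> ->] := divmod_block i kn.
exists s, u'; split.
  apply: (@good_list_orbits R d A B N n u' (y \o x) (fun=> 1%g)) => // [i|i|i k kn].
  - by case: (yP (x i)).
  - by case: (yP (x i)).
  - by rewrite sE// perm1 subrr mxOver0.
rewrite (sum_nat_mul (fun m => l1norm (s m - AR ^+ (m %% n) *m x (m %/ n)%N))).
rewrite (@le_trans _ _ (\sum_(i < N) C))//.
  apply: ler_sum => i _; have [_ _ _] := yP (x i); apply: le_trans.
  apply: ler_sum => k _; have [-> ->] := divmod_block i (ltn_ord k).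
  by rewrite sE// -mulmxBr.
rewrite sumr_const card_ord -[_ *+ _]mulr_natl natrM mulrCA ler_wpM2l//.
by rewrite mulrC -ler_pdivrMr// ltW// (lt_le_trans (truncnS_gt _))// ler_nat.
Qed.

End Refine.

(** * Continuous functions on the torus *)

Local Open Scope classical_set_scope.
Local Open Scope ring_scope.

Section TorusTopology.
Variables (R : realType) (d : nat).
Implicit Types (x y : 'cV[R]_d) (g : torus R d -> R).

Lemma torus_repr (p : torus R d) : exists x, torus_proj x = p.
Proof. by exists (repr p); rewrite /torus_proj reprK. Qed.

Lemma nbhs_l1norm x (e : R) : 0 < e -> \forall y \near x, l1norm (x - y) < e.
Proof.
move=> e0; have e1 : 0 < e / d.+1%:R by rewrite divr_gt0.
apply/nbhs_ballP; exists (e / d.+1%:R) => // y [_ xy].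
rewrite (@le_lt_trans _ _ (\sum_(i < d) e / d.+1%:R))//.
  by apply: ler_sum => i _; rewrite !mxE; apply: ltW; exact: xy.
rewrite sumr_const card_ord -[_ *+ _]mulr_natr mulrAC ltr_pdivrMr// ltr_pM2l//.
by rewrite ltr_nat.
Qed.

Lemma lipschitz_torus_continuous g (K : R) :
    (forall x y, `|g (torus_proj x) - g (torus_proj y)| <= K * l1norm (x - y)) ->
  continuous g.
Proof.
move=> gK; apply/quotient_continuous => x.
have Fx : Filter (nbhs x) by exact: nbhs_filter.
apply/cvgrPdist_lt => e e0.
have K1 : 0 < `|K| + 1 by rewrite ltr_wpDl.
near=> y; apply: le_lt_trans (gK x y) _.
rewrite (@le_lt_trans _ _ ((`|K| + 1) * l1norm (x - y)))//.
  by rewrite ler_wpM2r ?l1norm_ge0// (le_trans (ler_norm _))// lerDl.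
rewrite mulrC -ltr_pdivlMr//; near: y; apply: nbhs_l1norm.
by rewrite divr_gt0.
Unshelve. all: by end_near. Qed.

Let cube : set 'rV[R]_d := [set v | forall i, (`[0, 1]%classic : set R) (v ord0 i)].

Let cube_compact : compact cube.
Proof. by apply: (@rV_compact R d (fun=> `[0, 1]%classic)) => i; exact: segment_compact. Qed.

Let trmx_continuous : continuous (trmx : 'rV[R]_d -> 'cV[R]_d).
Proof.
move=> v A /nbhs_ballP[e e0 eA]; apply/nbhs_ballP; exists e => // w [_ vw].
by apply: eA; split=> // i j; rewrite !mxE; exact: vw.
Qed.

Let cube_floor x : cube ((x - floor_vec x)^T).
Proof.
by move=> i /=; have := floor_vec_le x i; rewrite !mxE in_itv/=; lra.
Qed.

Let torus_proj_sub_floor x : torus_proj (x - floor_vec x) = torus_proj x.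
Proof.
exact/torus_projDint/mxOver_intN/floor_vec_int.
Qed.

Lemma torus_compact : compact [set: torus R d].
Proof.
have -> : [set: torus R d] = (torus_proj \o trmx) @` cube.
  apply/seteqP; split=> // p _; have [x <-] := torus_repr p.
  by exists ((x - floor_vec x)^T) => //=; rewrite trmxK.
apply: continuous_compact => //; apply: continuous_subspaceT => v.
apply: continuous_comp; first exact: trmx_continuous.
exact: torus_proj_continuous.
Qed.

Lemma torus_continuous_bounded g : continuous g -> exists M, forall p, `|g p| <= M.
Proof.
move=> gc; have : compact (g @` setT).
  by apply: continuous_compact; [exact: continuous_subspaceT|exact: torus_compact].
move=> /compact_bounded [M [_ MP]]; exists (M + 1) => p.
by apply: (MP (M + 1)) => //; rewrite ltrDl.
Qed.

Lemma torus_unif_continuous g (e : R) : continuous g -> 0 < e ->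
  exists2 r, 0 < r & forall x y, l1norm (x - y) < r ->
    `|g (torus_proj x) - g (torus_proj y)| <= e.
Proof.
move=> gc e0; have cont x : {for x, continuous (g \o torus_proj)}.
  by apply: (@continuous_comp _ _ _ torus_proj g); [exact: torus_proj_continuous|exact: gc].
have near_x x : exists2 r, 0 < r & forall y, l1norm (x - y) < r ->
    `|g (torus_proj x) - g (torus_proj y)| < e / 2.
  have /cvgrPdist_lt/(_ (e / 2)) := cont x.
  move=> /(_ ltac:(lra)) /nbhs_ballP[r r0 rP]; exists r => // y xy.
  apply: rP; split=> // i j; rewrite [j]ord1.
  by have := ler_coord_l1norm (x - y) i; rewrite !mxE => /le_lt_trans; exact.
have : \forall r \near 0^'+, forall v, cube v -> forall y, l1norm (v^T - y) < r ->
    `|g (torus_proj v^T) - g (torus_proj y)| <= e.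
  have := cube_compact; rewrite compact_near_coveringP; apply.
  move=> v _; have [r r0 rP] := near_x v^T.
  have Fv : Filter (nbhs v) by exact: nbhs_filter.
  have r2 : 0 < r / 2 by lra.
  have near_v : \forall v' \near v, l1norm (v^T - v'^T) < r / 2.
    exact: (@trmx_continuous v _ (nbhs_l1norm v^T r2)).
  near=> v' r' => /= y v'y.
  have vv' : l1norm (v^T - v'^T) < r / 2.
    by near: v'.
  have r'r : r' < r / 2 by near: r'; exact: (nbhs_right_lt r2).
  have gv' := rP v'^T ltac:(lra).
  have : l1norm (v^T - y) < r.
    rewrite -(subrK v'^T v^T) -addrA (le_lt_trans (ler_l1normD _ _))//; lra.
  by move=> /rP; move: gv'; rewrite !ltr_norml ler_norml; lra.
move=> H; have [r [r0 rP]] := filter_ex (filterI (nbhs_right_gt (0 : R)) H).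
exists r => // x y xy.
have := rP _ (cube_floor x) (y - floor_vec x).
rewrite trmxK torus_proj_sub_floor opprB addrA subrK => /(_ xy).
suff -> : torus_proj (y - floor_vec x) = torus_proj y by [].
exact/torus_projDint/mxOver_intN/floor_vec_int.
Unshelve. all: by end_near. Qed.

(** Unlike a modulus of uniform continuity, this affine bound can be averaged
    over pairs of points whose distance is small only in the mean. *)
Lemma torus_affine_modulus g (e : R) : continuous g -> 0 < e ->
  exists2 K, 0 <= K & forall x y,
    `|g (torus_proj x) - g (torus_proj y)| <= e + K * l1norm (x - y).
Proof.
move=> gc e0; have [M gM] := torus_continuous_bounded gc.
have [r r0 rP] := torus_unif_continuous gc e0.
have M0 : 0 <= M by rewrite (le_trans _ (gM point)).
(* Beyond the distance r the trivial bound 2 M is enough. *)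
exists (2 * M / r) => [|x y]; first by rewrite divr_ge0// ?mulr_ge0// ltW.
have [xy|xy] := ltP (l1norm (x - y)) r.
  rewrite (le_trans (rP _ _ xy))// lerDl mulr_ge0 ?l1norm_ge0//.
  by rewrite divr_ge0// ?mulr_ge0// ltW.
rewrite (@le_trans _ _ (2 * M))//.
  rewrite (le_trans (ler_normB _ _))//.
  by have := gM (torus_proj x); have := gM (torus_proj y); lra.
apply: ler_wpDl; first exact: ltW.
by rewrite -mulrA ler_peMr ?mulr_ge0// mulrC ler_pdivlMr// mul1r.
Qed.

End TorusTopology.

(** * Distance to a subset and Borel measures on the torus *)

Section TorusDistance.
Variables (R : realType) (d : nat).
Implicit Types (x y : 'cV[R]_d) (C : set (torus R d)).

(** The distance is measured from one lift of p to all lifts of points of C;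
    all lifts of p give the same value ([tdistE]). *)
Definition tdist C (p : torus R d) : R :=
  inf [set l1norm (repr p - y) | y in torus_proj @^-1` C].

Lemma tdistE C x :
  tdist C (torus_proj x) = inf [set l1norm (x - y) | y in torus_proj @^-1` C].
Proof.
have : repr (torus_proj x) - x \is a mxOver Num.int.
  by apply/torus_projP; rewrite /torus_proj reprK.
rewrite /tdist; move: (repr _) => z zx; congr inf.
have xz : x - z \is a mxOver Num.int.
  by rewrite -opprB; exact: mxOver_intN.
apply/seteqP; split=> _ [y /= yC <-].
  exists (y + (x - z)); first by rewrite /= torus_projDint.
  by rewrite opprD addrCA subKr addrC.
exists (y + (z - x)); first by rewrite /= torus_projDint.
by rewrite opprD addrCA subKr addrC.
Qed.

Let has_inf_dist C x : C !=set0 ->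
  has_inf [set l1norm (x - y) | y in torus_proj @^-1` C].
Proof.
move=> [p Cp]; have [y yp] := torus_repr p; split.
  by exists (l1norm (x - y)), y => //=; rewrite yp.
by exists 0 => _ [z _ <-]; exact: l1norm_ge0.
Qed.

Lemma tdist_ge0 C p : C !=set0 -> 0 <= tdist C p.
Proof.
move=> C0; have [ne _] := has_inf_dist (repr p) C0.
by apply: lb_le_inf => // _ [y _ <-]; exact: l1norm_ge0.
Qed.

Lemma tdist_le C x y : C (torus_proj y) -> tdist C (torus_proj x) <= l1norm (x - y).
Proof.
move=> Cy; rewrite tdistE; apply: ge_inf; last by exists y.
by exists 0 => _ [z _ <-]; exact: l1norm_ge0.
Qed.

Lemma tdist_lt C x (e : R) : C !=set0 -> tdist C (torus_proj x) < e ->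
  exists2 y, C (torus_proj y) & l1norm (x - y) < e.
Proof.
move=> C0; rewrite tdistE => /(inf_lt (proj1 (has_inf_dist x C0)))[_ [y /= Cy <-] ye].
by exists y.
Qed.

Lemma tdist_lipschitz C x y : C !=set0 ->
  `|tdist C (torus_proj x) - tdist C (torus_proj y)| <= l1norm (x - y).
Proof.
move=> C0; wlog suff H : x y / tdist C (torus_proj x) <= tdist C (torus_proj y) + l1norm (x - y).
  have := H x y; have := H y x; rewrite -(l1normN (y - x)) opprB ler_norml; lra.
apply/ler_addgt0Pl => e e0.
have [z Cz zy] : exists2 z, C (torus_proj z) & l1norm (y - z) < tdist C (torus_proj y) + e.
  by apply: tdist_lt => //; rewrite ltrDl.
have := tdist_le x Cz; have := ler_l1normD (x - y) (y - z).
by rewrite addrA subrK; lra.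
Qed.

Lemma tdist_continuous C : C !=set0 -> continuous (tdist C).
Proof.
move=> C0; apply: (@lipschitz_torus_continuous _ _ _ 1) => x y.
by rewrite mul1r tdist_lipschitz.
Qed.

Lemma tdist0 C p : C p -> tdist C p = 0.
Proof.
move=> Cp; apply/eqP; rewrite eq_le tdist_ge0 ?andbT//; last by exists p.
have [x xp] := torus_repr p; rewrite -xp -(l1norm0 R d) -[0 in leRHS](subrr x).
by apply: tdist_le; rewrite xp.
Qed.

Lemma tdist_gt0 C p : closed C -> C !=set0 -> ~ C p -> 0 < tdist C p.
Proof.
move=> cC C0 nCp; rewrite lt_neqAle tdist_ge0// andbT eq_sym; apply/eqP => p0; apply: nCp.
have [x xp] := torus_repr p; rewrite -xp in p0 *.
have cC' : closed (torus_proj @^-1` C).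
  by apply: (closed_comp _ cC) => z _; exact: torus_proj_continuous.
apply: cC' => V /nbhs_ballP[e e0 eV].
have [|y Cy xy] := @tdist_lt C x e C0; first by rewrite p0.
exists y; split=> //; apply: eV; split=> // i j; rewrite [j]ord1.
by have := ler_coord_l1norm (x - y) i; rewrite !mxE => /le_lt_trans; exact.
Qed.

End TorusDistance.

Section TorusMeasure.
Variables (R : realType) (d : nat).
Implicit Types (g : torus R d -> R) (mu nu : prob_torus R d).

Lemma torus_continuous_measurable g : continuous g -> measurable_fun setT g.
Proof.
move=> gc; apply: (measurability _ (RGenOInfty.measurableE R)).
move=> _ [_ [x ->] <-]; rewrite setTI; apply: sub_sigma_algebra.
by move/continuousP: gc; apply; rewrite set_itvE; exact: open_gt.
Qed.

Lemma torus_continuous_integrable mu g : continuous g ->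
  mu.-integrable setT (EFin \o g).
Proof.
move=> gc; have [M gM] := torus_continuous_bounded gc.
apply: measurable_bounded_integrable => //.
- exact: (le_lt_trans (probability_le1 mu measurableT) (ltry _)).
- exact: torus_continuous_measurable.
- by exists M; split; [exact: num_real|move=> m Mm p _ /=; rewrite (le_trans (gM p))// ltW].
Qed.

(** For an open set U the functions min(1, n dist(x, U^c)) increase to the
    indicator of U, and open sets form a generating pi-system. *)
Lemma torus_prob_eq mu nu :
    (forall g, continuous g -> (\int[mu]_x g x = \int[nu]_x g x)%R) ->
  forall S, measurable S -> mu S = nu S.
Proof.
move=> eq_int; apply: (measure_unique (@open (torus R d)) (fun=> setT)) => //.
- by move=> ? ?; exact: openI.
- by move=> _; exact: openT.
- by rewrite bigcup_const.
- move=> U oU; have [->|UT] := pselect (U = setT); first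
    exact: (etrans (@probability_setT _ _ _ mu) (esym (@probability_setT _ _ _ nu))).
  have C0 : ~` U !=set0.
    by apply/set0P; apply: contra_notN UT => /eqP; rewrite -setCT => /setC_inj.
  have cC : closed (~` U) by exact: open_closedC.
  pose g n p := Num.min 1 (n%:R * tdist (~` U) p).
  have gc n : continuous (g n).
    apply: (@lipschitz_torus_continuous _ _ _ n%:R) => x y.
    have := tdist_lipschitz x y C0; rewrite /g.
    move: (tdist _ _) (tdist _ _) (l1norm _) => b a c abc.
    have : `|n%:R * a - n%:R * b| <= n%:R * c by rewrite -mulrBr normrM ger0_norm// ler_wpM2l.
    move: (n%:R * a) (n%:R * b) (n%:R * c) => a' b' c' abc'; move: abc'.
    by rewrite /Num.min !ler_norml; case: (ltP 1 a'); case: (ltP 1 b'); lra.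
  have mU : measurable U by exact: sub_sigma_algebra.
  have gU p : g ^~ p @ \oo --> (\1_U p : R).
    rewrite indicE; have [Up|nUp] := boolP (p \in U); last first.
      rewrite (_ : g ^~ p = fun=> 0); first exact: cvg_cst.
      apply/funext => n; rewrite /g tdist0 ?mulr0 ?min_r//.
      by move: nUp; rewrite notin_setE.
    have dp : 0 < tdist (~` U) p by apply: tdist_gt0 => // nUp; apply: nUp; rewrite inE in Up.
    apply: cvg_near_cst; near=> n; apply/eqP; rewrite /g min_l//.
    rewrite -ler_pdivrMr// mul1r; near: n; exact: nbhs_infty_ger.
  have cvgU (m : prob_torus R d) : ((\int[m]_x (g n x)%:E) @[n --> \oo] --> m U)%E.
    have [||||| _ _] := @dominated_convergence _ _ _ m setT measurableT
      (fun n x => (g n x)%:E) (EFin \o \1_U) (cst 1%E).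
    - by move=> n; apply/measurable_EFinP; exact: torus_continuous_measurable (gc n).
    - by apply/measurable_EFinP; exact: measurable_indic.
    - by apply: aeW => x _; apply: cvg_EFin; [exact: nearW|exact: gU].
    - by apply: finite_measure_integrable_cst.
    - apply: aeW => x n _; rewrite /= lee_fin ger0_norm ?ge_min ?lexx//.
      by rewrite /g le_min ler01 mulr_ge0// tdist_ge0.
    have -> : (\int[m]_x (EFin \o \1_U) x = m U)%E by rewrite integral_indic// setIT.
    exact.
  have := cvgU mu; rewrite (_ : (fun n => _) = fun n => \int[nu]_x (g n x)%:E)%E.
    by move=> /cvg_unique; apply; [exact: ereal_hausdorff|exact: cvgU].
  apply/funext => n; have := eq_int _ (gc n); rewrite /Rintegral => eqf.
  rewrite -[LHS]fineK; last exact: integrable_fin_num (torus_continuous_integrable _ (gc n)).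
  rewrite -[RHS]fineK; last exact: integrable_fin_num (torus_continuous_integrable _ (gc n)).
  by rewrite eqf.
- by move=> k; exact: (le_lt_trans (probability_le1 mu measurableT) (ltry _)).
Unshelve. all: by end_near. Qed.

End TorusMeasure.

(** * Equal cells of the unit interval *)

Section CellIndex.
Variable R : realType.
Local Notation P := (uniform_prob (@ltr01 R)).

(** Clamping to L - 1 makes the cells a partition of the whole line, so that
    step functions need no convention outside the unit interval. *)
Definition cell_index (L : nat) (t : R) : nat := minn (Num.trunc (L%:R * t)) L.-1.

Lemma cell_index_lt L t : (0 < L)%N -> (cell_index L t < L)%N.
Proof. by rewrite /cell_index; lia. Qed.

Lemma leq_truncn_nat k (x : R) : (0 < k)%N -> (k <= Num.trunc x)%N = (k%:R <= x).
Proof. by case: k => // k _; rewrite leNgt -truncn_le_nat ltnNge. Qed.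

Lemma cell_index_div L n t : (0 < L)%N -> (0 < n)%N ->
  (cell_index (L * n) t %/ n)%N = cell_index L t.
Proof.
move=> L0 n0; suff le_eq k : (0 < k)%N ->
    (k <= cell_index (L * n) t %/ n)%N = (k <= cell_index L t)%N.
  apply/eqP; rewrite eqn_leq; apply/andP; split.
    by case: (posnP (cell_index (L * n) t %/ n)) => [-> //|h]; rewrite -le_eq.
  by case: (posnP (cell_index L t)) => [-> //|h]; rewrite le_eq.
move=> k0; rewrite leq_divRL// /cell_index !leq_min !leq_truncn_nat ?muln_gt0 ?k0//.
rewrite !natrM mulrAC ler_pM2r ?ltr0n//; congr (_ && _).
have -> a b : (0 < b)%N -> (a <= b.-1)%N = (a < b)%N by case: b.
  by rewrite ltn_mul2r n0/=; case: (L) L0.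
by rewrite muln_gt0 L0.
Qed.

Lemma cell_indexE L i : (i < L)%N -> [set t | cell_index L t = i] =
  (if i == 0%N then setT else `[i%:R / L%:R, +oo[%classic) `&`
  (if i == L.-1 then setT else `]-oo, i.+1%:R / L%:R[%classic).
Proof.
move=> iL; have L0 : (0 < L)%N by lia.
have leE t : (i <= cell_index L t)%N <-> (if i == 0%N then setT else `[i%:R / L%:R, +oo[%classic) t.
  case: eqVneq => [->//|i0]; rewrite /= in_itv/= andbT ler_pdivrMr ?ltr0n// mulrC.
  by rewrite leq_min leq_truncn_nat ?lt0n// andb_idr//; lia.
have geE t : (cell_index L t <= i)%N <-> (if i == L.-1 then setT else `]-oo, i.+1%:R / L%:R[%classic) t.
  case: eqVneq => [->//|i0].
    by rewrite geq_minr.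
  rewrite /= in_itv/= ltr_pdivlMr ?ltr0n// mulrC -truncn_le_nat.
  by rewrite geq_min orb_idr//; lia.
apply/seteqP; split=> t /=.
  by move=> E; split; [apply/leE|apply/geE]; rewrite E.
by move=> [/leE h1 /geE h2]; apply/eqP; rewrite eqn_leq h1 h2.
Qed.

Lemma measurable_cell L i : (i < L)%N -> measurable [set t | cell_index L t = i].
Proof.
by move=> iL; rewrite cell_indexE//; apply: measurableI; case: ifP.
Qed.

Lemma prob_cell L i : (i < L)%N -> P [set t | cell_index L t = i] = (L%:R^-1)%:E.
Proof.
move=> iL; have L0 : (0 < L)%N by lia.
rewrite cell_indexE// /uniform_prob integral_uniform_pdf.
set D := (X in (\int[_]_(x in X) _)%E).
have -> : D = [set` Interval (BLeft (i%:R / L%:R))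
    (if i == L.-1 then BRight (1 : R) else BLeft (i.+1%:R / L%:R))].
  have iL0 : 0 <= i%:R / L%:R :> R by rewrite divr_ge0.
  have iL1 : i.+1%:R / L%:R <= 1 :> R by rewrite ler_pdivrMr ?ltr0n// mul1r ler_nat.
  rewrite /D; apply/seteqP; split=> t /=; rewrite !in_itv/=.
    by case: eqVneq => [i0|_]; case: eqVneq => _ /=; rewrite ?in_itv/= ?i0 ?mul0r; lra.
  have [i0|_] := eqVneq i 0%N; first rewrite i0 in iL1 *.
    by case: eqVneq => _ /=; rewrite ?in_itv/= ?mul0r => ?; repeat split; lra.
  by case: eqVneq => _ /=; rewrite ?in_itv/= ?andbT => ?; repeat split; lra.
rewrite (eq_integral (fun=> 1%E)); last first.
  move=> t; rewrite inE/= in_itv/= => tD; rewrite /uniform_pdf ifT ?subr0 ?invr1//.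
  have : 0 <= i%:R / L%:R :> R by rewrite divr_ge0.
  have : i.+1%:R / L%:R <= 1 :> R by rewrite ler_pdivrMr ?ltr0n// mul1r ler_nat.
  by move: tD; case: eqVneq => _ /=; lra.
rewrite integral_cst//= mul1e lebesgue_measure_itv/=.
have iS : i.+1%:R / L%:R = i%:R / L%:R + L%:R^-1 :> R by rewrite -addn1 natrD mulrDl mul1r.
have Li0 : 0 < L%:R^-1 :> R by rewrite invr_gt0 ltr0n.
case: eqVneq => [iE|_] /=; rewrite lte_fin.
  have E1 : 1 = i.+1%:R / L%:R :> R by rewrite iE prednK// divff// pnatr_eq0 -lt0n.
  move: Li0 E1 iS; move: (i%:R / L%:R) (i.+1%:R / L%:R) => a b; move: L%:R^-1 => c c0 -> ->.
  by rewrite ltrDl c0 -EFinB addrAC subrr add0r.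
by rewrite iS ltrDl Li0 -EFinB addrAC subrr add0r.
Qed.

Section Step.
Variables (L : nat) (L0 : (0 < L)%N).
Implicit Types F : nat -> R.

Lemma cell_stepE F t :
  F (cell_index L t) = \sum_(i < L) F i * \1_[set t | cell_index L t = i] t.
Proof.
rewrite (bigD1 (Ordinal (cell_index_lt t L0)))//= indicE mem_set//= mulr1.
rewrite big1 ?addr0// => i ni; rewrite indicE memNset ?mulr0//= => E.
by move/eqP: ni; apply; apply/val_inj.
Qed.

Lemma measurable_cell_step F : measurable_fun setT (fun t : R => F (cell_index L t)).
Proof.
under eq_fun do rewrite cell_stepE.
apply: measurable_sum => i; apply: measurable_funM => //.
by apply: measurable_indic; exact: measurable_cell.
Qed.

Lemma integral_cell_step F : (forall i, 0 <= F i) ->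
  (\int[P]_t (F (cell_index L t))%:E = (L%:R^-1 * \sum_(i < L) F i)%:E)%E.
Proof.
move=> F0; under eq_integral do rewrite cell_stepE -sumEFin.
rewrite ge0_integral_sum//=.
- rewrite mulr_sumr -sumEFin; apply: eq_bigr => i _.
  under eq_integral do rewrite EFinM.
  rewrite ge0_integralZl//=.
  + rewrite integral_indic// ?setIT; last exact: measurable_cell.
    by rewrite [X in (_ * X)%E]prob_cell// -EFinM mulrC.
  + by apply/measurable_EFinP; apply: measurable_indic; exact: measurable_cell.
  + by rewrite lee_fin.
- move=> i; apply/measurable_EFinP; apply: measurable_funM => //.
  by apply: measurable_indic; exact: measurable_cell.
- by move=> i t _; rewrite lee_fin mulr_ge0.
Qed.

End Step.
End CellIndex.

(** * Limits of nested lists of points *)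

Section Limit.
Variables (R : realType) (d : nat).
Local Notation P := (uniform_prob (@ltr01 R)).

Lemma integrable_cell_step L (F : nat -> R) : (0 < L)%N ->
  P.-integrable setT (EFin \o (fun t => F (cell_index L t))).
Proof.
move=> L0; apply/integrableP; split.
  by apply/measurable_EFinP; exact: measurable_cell_step.
under eq_integral do rewrite /=.
by rewrite (integral_cell_step L0 (fun i => normr_ge0 (F i))) ltry.
Qed.

Lemma Rintegral_cell_step L (F : nat -> R) : (0 < L)%N ->
  (\int[P]_t F (cell_index L t))%R = L%:R^-1 * \sum_(i < L) F i.
Proof.
move=> L0; pose F1 i := `|F i|; pose F2 i := `|F i| - F i.
have F2_ge0 i : 0 <= F2 i by rewrite subr_ge0 ler_norm.
rewrite (_ : (fun t => F (cell_index L t)) =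
   (fun t => F1 (cell_index L t) - F2 (cell_index L t))); last first.
  by apply/funext => t; rewrite /F2 subKr.
rewrite RintegralB//; [|exact: integrable_cell_step..].
rewrite /Rintegral (integral_cell_step L0 F2_ge0).
rewrite (integral_cell_step L0 (fun i => normr_ge0 (F i)))/=.
rewrite -mulrBr -sumrB.
by congr (_ * _); apply: eq_bigr => i _; rewrite /F2 subKr.
Qed.

Lemma cvg_coord (z : 'cV[R]_d) (x : nat -> 'cV[R]_d) :
  (forall c, x j c 0 @[j --> \oo] --> z c 0) -> x j @[j --> \oo] --> z.
Proof.
move=> xz A /nbhs_ballP[e e0 eA].
have : \forall j \near \oo, forall c, `|z c 0 - x j c 0| < e.
  apply: (@filter_forall nat 'I_d (fun c j => `|z c 0 - x j c 0| < e) \oo) => c.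
  by have /cvgrPdist_lt := xz c; apply.
apply: filterS => j xj; apply: eA; split=> // c c'; rewrite [c']ord1; exact: xj.
Qed.

Lemma measurable_torus_coord (Z : 'I_d -> R -> R) :
    (forall c, measurable_fun setT (Z c)) ->
  measurable_fun setT (fun t : measurableTypeR R => torus_proj (\col_c Z c t)).
Proof.
move=> mZ; pose Zt (t : measurableTypeR R) := [tuple Z c t | c < d].
apply: (eq_measurable_fun (@tuple_torus R d \o Zt)) => [t _|].
  rewrite /= /tuple_torus; congr torus_proj.
  by apply/matrixP => i j; rewrite !mxE tnth_mktuple.
apply: (measurableT_comp (@tuple_torus_measurable R d)).
apply/measurable_fun_tnthP => c; apply: (eq_measurable_fun (Z c)) => [t _|].
  by rewrite /= tnth_mktuple.
exact: mZ.
Qed.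

Lemma law_on_torus (f : measurableTypeR R -> torus R d) : measurable_fun setT f ->
  exists nu : prob_torus R d, forall g : torus R d -> R, continuous g ->
    (\int[nu]_p g p)%R = (\int[P]_t g (f t))%R.
Proof.
move=> mf; pose f' : {mfun (measurableTypeR R) >-> torus R d} :=
  HB.pack f (isMeasurableFun.Build _ _ _ _ f mf).
exists (distribution P f') => g gc; rewrite /Rintegral; congr fine.
have mg := torus_continuous_measurable gc.
rewrite (@integral_distribution _ _ _ _ _ P f' (EFin \o g))//.
- exact/measurable_EFinP.
- have [M gM] := torus_continuous_bounded gc.
  apply: (@measurable_bounded_integrable _ _ _ P (g \o f')) => //.
  + exact: (le_lt_trans (probability_le1 P measurableT) (ltry _)).
  + exact: measurableT_comp.
  + exists M; split; first exact: num_real.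
    by move=> m Mm p _ /=; rewrite (le_trans (gM _))// ltW.
Qed.

Variables (L n : nat -> nat) (s : nat -> nat -> 'cV[R]_d).
Hypothesis L0 : forall j, (0 < L j)%N.
Hypothesis LS : forall j, L j.+1 = (L j * n j)%N.
Hypothesis sS : forall j, \sum_(m < L j.+1) l1norm (s j.+1 m - s j (m %/ n j)%N) <=
  (2^-1) ^+ j * (L j.+1)%:R.

Let n0 j : (0 < n j)%N.
Proof. by have := L0 j.+1; rewrite LS muln_gt0 => /andP[]. Qed.

Let X j (t : R) := s j (cell_index (L j) t).
Let jump j (t : R) := l1norm (X j.+1 t - X j t).

Let gap j m := l1norm (s j.+1 m - s j (m %/ n j)%N).

Let jumpE j t : jump j t = gap j (cell_index (L j.+1) t).
Proof. by rewrite /gap /jump /X -(cell_index_div t (L0 j) (n0 j)) -LS. Qed.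

Let jump_ge0 j t : (0 <= (jump j t)%:E)%E.
Proof. by rewrite lee_fin l1norm_ge0. Qed.

Let measurable_jump j : measurable_fun setT (fun t => (jump j t)%:E).
Proof.
apply/measurable_EFinP; apply: (eq_measurable_fun (fun t => gap j (cell_index (L j.+1) t))).
  by move=> t _; rewrite jumpE.
exact: measurable_cell_step (L0 j.+1) (gap j).
Qed.

Let total_jump (t : R) := (\sum_(j <oo) (jump j t)%:E)%E.

Let total_jump_integrable : P.-integrable setT total_jump.
Proof.
apply/integrableP; split.
  by apply: ge0_emeasurable_sum => [j t _ _|j _]; [exact: jump_ge0|exact: measurable_jump].
under eq_integral => t _ do rewrite gee0_abs ?nneseries_ge0//.
rewrite integral_nneseries//.
apply: (@le_lt_trans _ _ (\sum_(j <oo) ((2^-1) ^+ j)%:E)%E).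
  apply: lee_nneseries => [j _ _|j _]; first exact: integral_ge0.
  under eq_integral do rewrite jumpE.
  rewrite (integral_cell_step (L0 j.+1) (fun m => l1norm_ge0 _ : 0 <= gap j m)) lee_fin.
  by rewrite mulrC ler_pdivrMr ?ltr0n.
have partial_le k : (\sum_(0 <= j < k) (2^-1 : R) ^+ j) = 2 - 2 * (2^-1) ^+ k.
  elim: k => [|k IH]; first by rewrite big_nil expr0; lra.
  by rewrite big_nat_recr//= IH exprS; lra.
apply: (@le_lt_trans _ _ 2%:E); last exact: ltry.
apply: lime_le.
  by apply: is_cvg_nneseries => j _ _; rewrite lee_fin exprn_ge0// invr_ge0.
apply: nearW => k; rewrite sumEFin lee_fin partial_le lerBlDl lerDr.
by rewrite mulr_ge0// exprn_ge0// invr_ge0.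
Qed.

Let is_cvg_X t c : total_jump t \is a fin_num -> cvgn (fun j => X j t c 0).
Proof.
move=> fin_t; pose u j := X j.+1 t c 0 - X j t c 0.
have u_jump j : `|u j| <= jump j t.
  by have := ler_coord_l1norm (X j.+1 t - X j t) c; rewrite !mxE.
have cvgu : cvgn (series u).
  apply: normed_cvg; apply: nondecreasing_is_cvgn.
    by apply: nondecreasing_series => j _ _ /=; exact: normr_ge0.
  exists (fine (total_jump t)) => _ [k _ <-].
  rewrite -lee_fin fineK// /series/= -sumEFin.
  apply: le_trans (nneseries_lim_ge (P := xpredT) (m := 0) k (fun j _ _ => jump_ge0 j t)).
  by apply: lee_sum => j _; rewrite lee_fin.
have -> : (fun j => X j t c 0) = (fun j => series u j + X 0%N t c 0).
  by apply/funext => j; rewrite /series/= telescope_sumr// subrK.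
by apply: is_cvgD => //; exact: is_cvg_cst.
Qed.

(** Read the j-th list as a step function on [0, 1] with L j equal cells. The
    expected jumps between consecutive step functions are summable, so the sum
    of the jumps is finite almost everywhere and the step functions converge
    there; dominated convergence identifies the integrals against the law of
    the limit. *)
Lemma list_limit : exists nu : prob_torus R d,
  forall g : torus R d -> R, continuous g ->
    (L j)%:R^-1 * \sum_(m < L j) g (torus_proj (s j m)) @[j --> \oo] -->
    (\int[nu]_p g p)%R.
Proof.
have [N [mN PN0 subN]] := integrable_ae measurableT total_jump_integrable.
have finN t : ~ N t -> total_jump t \is a fin_num.
  by move=> nNt; apply: contrapT => nfin; apply: nNt; apply: subN => /= /(_ I).
(* Set to 0 on the null set N, the coordinates converge everywhere, which makes
   the limit measurable. *)
pose Y j (c : 'I_d) t := X j t c 0 * \1_(~` N) t.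
pose Z (c : 'I_d) t := limn (fun j => Y j c t).
have cvgY c t : Y j c t @[j --> \oo] --> Z c t.
  rewrite /Z /Y; have [Nt|nNt] := pselect (N t).
    rewrite indicE memNset ?mulr0; last by move=> /(_ Nt).
    by under eq_fun do rewrite mulr0; exact: is_cvg_cst.
  rewrite indicE mem_set//; under eq_fun do rewrite mulr1.
  exact: is_cvg_X (finN _ nNt).
have mZ c : measurable_fun setT (Z c).
  apply: (measurable_fun_cvg (h := fun j => Y j c)) => [j|t _]; last exact: cvgY.
  apply: measurable_funM.
    exact: (measurable_cell_step (L0 j) (fun m => s j m c 0)).
  by apply: measurable_indic; exact: measurableC.
have mtZ := measurable_torus_coord mZ.
have [nu nuE] := law_on_torus mtZ; exists nu => g gc; rewrite nuE//.
have [M gM] := torus_continuous_bounded gc.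
have mg := torus_continuous_measurable gc.
have mgZ : measurable_fun setT (fun t => g (torus_proj (\col_c Z c t))).
  exact: (measurableT_comp mg mtZ).
have [||||| _ _] := @dominated_convergence _ _ _ P setT measurableT
  (fun j t => (g (torus_proj (X j t)))%:E)
  (fun t => (g (torus_proj (\col_c Z c t)))%:E) (cst M%:E).
- move=> j; apply/measurable_EFinP.
  exact: (measurable_cell_step (L0 j) (fun m => g (torus_proj (s j m)))).
- exact/measurable_EFinP.
- exists N; split=> // t /= ncv; apply: contrapT => nNt; apply: ncv => _.
  apply: cvg_EFin; first exact: nearW.
  have /= gpc : {for (\col_c Z c t), continuous (g \o torus_proj)}.
    by apply: (@continuous_comp _ _ _ torus_proj g); [exact: torus_proj_continuous|exact: gc].
  apply: (cvg_comp (fun j => X j t) _ _ gpc); apply: cvg_coord => c; rewrite mxE.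
  have := cvgY c t; rewrite /Y indicE mem_set//.
  by under eq_fun do rewrite mulr1.
- exact: finite_measure_integrable_cst.
- by apply: aeW => t j _; rewrite /= lee_fin.
have intfin : P.-integrable setT (fun t => (g (torus_proj (\col_c Z c t)))%:E).
  apply: (measurable_bounded_integrable (mu := P)) => //.
    exact: (le_lt_trans (probability_le1 P measurableT) (ltry _)).
  by exists M; split; [exact: num_real|move=> m Mm p _ /=; rewrite (le_trans (gM _))// ltW].
rewrite -[X in _ --> X -> _]fineK; last exact: integrable_fin_num intfin.
move=> /fine_cvg; apply: cvg_trans; apply: near_eq_cvg; apply: nearW => j /=.
by rewrite -(Rintegral_cell_step (fun m => g (torus_proj (s j m))) (L0 j)).
Qed.

End Limit.

(** * Finite averages approximating integrals *)

(** Take each point x c with multiplicity the integer part of m w(c), for m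
    large. *)
Lemma convex_finite_average (R : realType) (T : Type) (J I : finType)
    (w : J -> R) (x : J -> T) (F : I -> T -> R) (M e : R) :
    (forall c, 0 <= w c) -> \sum_c w c = 1 -> (forall i p, `|F i p| <= M) -> 0 < e ->
  exists N (y : nat -> T), (0 < N)%N /\ forall i,
    `|\sum_c w c * F i (x c) - N%:R^-1 * \sum_(k < N) F i (y k)| <= e.
Proof.
move=> w0 w1 FM e0.
have [c0 _|J0] := pickP (@predT J); last first.
  move: w1; rewrite big_pred0 => [/eqP|c]; first by rewrite eq_sym oner_eq0.
  by have := J0 c.
have [[i0 _]|I0] := pselect (exists i : I, True); last first.
  by exists 1%N, (fun=> x c0); split=> // i; case: I0; exists i.
have M0 : 0 <= M := le_trans (normr_ge0 _) (FM i0 (x c0)).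
(* Taking integer parts loses at most #|J| of the total multiplicity m; what
   remains must exceed 2 #|J| M / e. *)
pose m := (Num.trunc (2 * #|J|%:R * M / e) + 1 + #|J|)%N.
pose k c := Num.trunc (m%:R * w c).
pose xs := flatten [seq nseq (k c) (x c) | c <- enum J].
have sum_xs (G : T -> R) : \sum_(j < size xs) G (nth (x c0) xs j) = \sum_c (k c)%:R * G (x c).
  rewrite -(big_mkord xpredT (fun j => G (nth (x c0) xs j))) -(big_nth _ xpredT).
  rewrite /xs big_flatten/= big_map big_enum; apply: eq_bigr => c _.
  by rewrite big_nseq iter_addr_0 mulr_natl.
have NE : (size xs)%:R = \sum_c (k c)%:R :> R.
  have := sum_xs (fun=> 1); rewrite sumr_const card_ord => ->.
  by apply: eq_bigr => c _; rewrite mulr1.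
have kP c : 0 <= m%:R * w c - (k c)%:R <= 1.
  have /andP[h1 h2] : (k c)%:R <= m%:R * w c < (k c).+1%:R by apply: truncn_itv; rewrite mulr_ge0.
  by move: h1 h2; rewrite -natr1; lra.
have mN : 0 <= (m%:R - (size xs)%:R : R) <= #|J|%:R.
  have -> : m%:R - (size xs)%:R = \sum_c (m%:R * w c - (k c)%:R) :> R.
    by rewrite sumrB -mulr_sumr w1 mulr1 NE.
  apply/andP; split; first by apply: sumr_ge0 => c _; case/andP: (kP c).
  rewrite -sum1_card natr_sum; apply: ler_sum => c _; by case/andP: (kP c).
have Nge : 2 * #|J|%:R * M / e < (size xs)%:R.
  have := truncnS_gt (2 * #|J|%:R * M / e); move: mN; rewrite /m !natrD -addn1 natrD; lra.
have N0 : 0 < (size xs)%:R :> R by apply: le_lt_trans Nge; rewrite divr_ge0 ?mulr_ge0// ltW.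
exists (size xs), (nth (x c0) xs); split=> [|i]; first by rewrite -(ltr_nat R).
rewrite sum_xs; set S := \sum_c _; set K := \sum_c _.
have SM : `|S| <= M.
  rewrite (le_trans (ler_norm_sum _ _ _))// (@le_trans _ _ (\sum_c w c * M))//.
    by apply: ler_sum => c _; rewrite normrM ger0_norm// ler_wpM2l.
  by rewrite -mulr_suml w1 mul1r.
have NSK : `|(size xs)%:R * S - K| <= 2 * #|J|%:R * M.
  have -> : (size xs)%:R * S - K =
      \sum_c (m%:R * w c - (k c)%:R) * F i (x c) - (m%:R - (size xs)%:R) * S.
    rewrite mulrBl opprB [RHS]addrC addrAC -addrA; congr (_ + _).
    under eq_bigr do rewrite mulrBl -mulrA.
    by rewrite sumrB -mulr_sumr addrC addrA addNr add0r.
  rewrite (le_trans (ler_normB _ _))// -mulrA mulr_natl mulr2n; apply: lerD.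
    rewrite (le_trans (ler_norm_sum _ _ _))// -sum1_card natr_sum mulr_suml.
    apply: ler_sum => c _; have /andP[h1 h2] := kP c.
    by rewrite normrM ger0_norm// ler_pM.
  by have /andP[h1 h2] := mN; rewrite normrM ger0_norm// ler_pM.
rewrite -(ler_pM2l N0) -{1}(ger0_norm (ltW N0)) -normrM mulrBr mulVKf ?gt_eqF//.
apply: le_trans NSK _; move: Nge; rewrite ltr_pdivrMr// => /ltW.
done.
Qed.

Section Averages.
Variables (R : realType) (d : nat).

(** Cut the space into the finitely many cells on which all F i are constant up
    to e / 2, and replace each cell by one of its points. *)
Lemma integral_finite_average (mu : prob_torus R d) (I : finType)
    (F : I -> torus R d -> R) (M e : R) :
    (forall i, measurable_fun setT (F i)) -> (forall i p, `|F i p| <= M) -> 0 < e ->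
  exists N (y : nat -> torus R d), (0 < N)%N /\ forall i,
    `|(\int[mu]_p F i p)%R - N%:R^-1 * \sum_(k < N) F i (y k)| <= e.
Proof.
move=> mF FM e0; pose K := (Num.trunc (2 * M / (e / 2))).+1.
have e2 : 0 < e / 2 by lra.
pose q0 i p := Num.trunc ((F i p + M) / (e / 2)).
have FM0 i p : 0 <= (F i p + M) / (e / 2).
  apply: divr_ge0; last exact: ltW.
  by have := FM i p; rewrite ler_norml; lra.
have q0K i p : (q0 i p < K)%N.
  rewrite /q0 /K ltnS; apply: le_truncn.
  by rewrite ler_pM2r ?invr_gt0//; have := FM i p; rewrite ler_norml; lra.
pose q p : {ffun I -> 'I_K} := [ffun i => Ordinal (q0K i p)].
pose Q c := [set p | q p = c].
have QE c : Q c = \bigcap_(i in [set: I])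
    [set p | (c i)%:R <= (F i p + M) / (e / 2) < (c i).+1%:R].
  apply/seteqP; split=> p.
    move=> <- i _ /=; rewrite ffunE /=; exact: truncn_itv.
  move=> h; apply/ffunP => i; rewrite ffunE; apply/val_inj => /=.
  by apply: truncn_def; exact: h.
have mQ c : measurable (Q c).
  rewrite QE; apply: fin_bigcap_measurable => [|i _]; first exact: finite_finset.
  have mf : measurable_fun setT (fun p => (F i p + M) / (e / 2)).
    by apply: measurable_funM => //; apply: measurable_funD.
  have := mf measurableT _ (measurable_itv `[(c i)%:R, (c i).+1%:R[).
  by rewrite setTI; congr measurable; apply/seteqP; split=> p /=; rewrite in_itv.
pose w c := fine (mu (Q c)).
pose x c := if pselect (exists p, Q c p) is left h then sval (cid h) else point.
have xP p : Q (q p) (x (q p)).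
  by rewrite /x; case: pselect => [h|[]]; [exact: svalP (cid h)|exists p].
have Fx i p : `|F i p - F i (x (q p))| <= e / 2.
  have := xP p; rewrite /Q/= => /ffunP/(_ i)/(congr1 val); rewrite !ffunE/= /q0 => E.
  have /andP[h1 h2] := truncn_itv (FM0 i p); have /andP[h3 h4] := truncn_itv (FM0 i (x (q p))).
  rewrite ?E -?[X in _ < X]natr1 in h1 h2 h3 h4.
  rewrite ler_pdivlMr// in h1; rewrite ler_pdivlMr// in h3.
  rewrite ltr_pdivrMr// in h2; rewrite ltr_pdivrMr// in h4.
  by rewrite ler_norml; nra.
have indq h p : h (q p) = \sum_c h c * \1_(Q c) p :> R.
  rewrite (bigD1 (q p))//= indicE mem_set// mulr1 big1 ?addr0// => c cq.
  by rewrite indicE memNset ?mulr0// => E; rewrite /Q/= in E; rewrite E eqxx in cq.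
have mindic c : measurable_fun setT (\1_(Q c) : torus R d -> R).
  by apply: measurable_indic; exact: mQ.
have integrable_bdd (h : torus R d -> R) (M' : R) : measurable_fun setT h ->
    (forall p, `|h p| <= M') -> mu.-integrable setT (EFin \o h).
  move=> mh hM; apply: measurable_bounded_integrable => //.
    exact: (le_lt_trans (probability_le1 mu measurableT) (ltry _)).
  by exists M'; split; [exact: num_real|move=> m Mm p _ /=; rewrite (le_trans (hM p))// ltW].
have iindic c : mu.-integrable setT (EFin \o (\1_(Q c) : torus R d -> R)).
  apply: (integrable_bdd _ 1) => // p.
  by rewrite indicE; case: (_ \in _); rewrite ?normr1 ?normr0.
have iterm h c : mu.-integrable setT (fun p => (h * \1_(Q c) p)%:E).
  under eq_fun do rewrite EFinM; apply: integrableZl => //; exact: iindic.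
have intq (h : {ffun I -> 'I_K} -> R) : (\int[mu]_p h (q p))%R = \sum_c w c * h c.
  rewrite /Rintegral; under eq_integral do rewrite indq -sumEFin.
  rewrite integral_sum// -sum_fine; last by move=> c _; exact: integrable_fin_num.
  apply: eq_bigr => c _; under eq_integral do rewrite EFinM.
  rewrite (integralZl measurableT (iindic c)) integral_indic// setIT /w mulrC fineM//.
  exact: fin_num_measure.
have w1 : \sum_c w c = 1.
  have := intq (fun=> 1); rewrite Rintegral_cst// mul1r.
  have -> : fine (mu setT) = 1 by rewrite (_ : mu setT = 1%E)//; exact: probability_setT.
  by move=> ->; apply: eq_bigr => c _; rewrite mulr1.
have w0 c : 0 <= w c by rewrite fine_ge0.
have [N [y [N0 yP]]] := convex_finite_average x w0 w1 FM e2.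
exists N, y; split=> // i.
have mG : measurable_fun setT (fun p => F i (x (q p))).
  under eq_fun do rewrite (indq (fun c => F i (x c))).
  by apply: measurable_sum => c; apply: measurable_funM.
have diff : `|(\int[mu]_p F i p)%R - (\int[mu]_p F i (x (q p)))%R| <= e / 2.
  have iF : mu.-integrable setT (EFin \o F i) by exact: integrable_bdd (FM i).
  have iG : mu.-integrable setT (EFin \o (fun p => F i (x (q p)))).
    by apply: integrable_bdd => // p; exact: FM.
  rewrite -RintegralB//.
  have iFG : mu.-integrable setT (EFin \o (fun p => F i p - F i (x (q p)))).
    by apply: (integrable_bdd _ (e / 2)) => //; exact: measurable_funB.
  apply: le_trans (le_normr_Rintegral _ _) _ => //.
  apply: (@le_trans _ _ (\int[mu]_p (e / 2))%R).
    apply: le_Rintegral => //; last exact: finite_measure_integrable_cst.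
    apply: (integrable_bdd _ (e / 2)) => [|p]; last by rewrite normr_id.
    by apply: measurableT_comp => //; exact: measurable_funB.
  rewrite Rintegral_cst//.
  have -> : fine (mu setT) = 1 by rewrite (_ : mu setT = 1%E)//; exact: probability_setT.
  by rewrite mulr1.
by have := yP i; rewrite -(intq (fun c => F i (x c))); move: diff; rewrite !ler_norml; lra.
Qed.

End Averages.

(** * Invariant measures approximated by lists *)

Section Push.
Variables (R : realType) (d : nat).
Implicit Types (mu : prob_torus R d) (g : torus R d -> R).

Lemma torus_continuous_comp_endo M g : continuous g ->
  continuous (g \o toral_endo M).
Proof.
move=> gc p; apply: (@continuous_comp _ _ _ (toral_endo M) g); last exact: gc.
exact: toral_endo_continuous.
Qed.

Lemma Rintegral_push_endo M mu g : continuous g ->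
  (\int[push_endo M mu]_p g p)%R = (\int[mu]_p g (toral_endo M p))%R.
Proof.
move=> gc; rewrite /Rintegral; congr fine.
rewrite (@integral_distribution _ _ _ _ _ mu (toral_endo M) (EFin \o g))//.
  by apply/measurable_EFinP; exact: torus_continuous_measurable.
exact: (torus_continuous_integrable mu (torus_continuous_comp_endo gc)).
Qed.

Lemma Rintegral_invariant M mu g : invariant_prob R M mu -> continuous g ->
  (\int[mu]_p g (toral_endo M p))%R = (\int[mu]_p g p)%R.
Proof.
move=> inv gc; rewrite -Rintegral_push_endo//; congr fine.
by apply: eq_measure_integral => S mS _; exact: inv.
Qed.

Lemma Rintegral_invariant_iter M mu g k : invariant_prob R M mu -> continuous g ->
  (\int[mu]_p g (iter k (toral_endo M) p))%R = (\int[mu]_p g p)%R.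
Proof.
move=> inv; elim: k g => [//|k IH] g gc.
rewrite -[RHS](Rintegral_invariant inv gc) -[RHS]IH//.
exact: torus_continuous_comp_endo.
Qed.

Lemma invariant_prob_criterion M mu :
    (forall g, continuous g ->
      (\int[mu]_p g (toral_endo M p))%R = (\int[mu]_p g p)%R) ->
  invariant_prob R M mu.
Proof.
move=> inv S mS; apply: torus_prob_eq mS => g gc.
by rewrite Rintegral_push_endo// inv.
Qed.

End Push.

Section Approx.
Variables (R : realType) (d : nat) (A B : 'M[int]_d).
Local Notation AR := (map_mx intr A : 'M[R]_d).
Hypothesis d0 : (0 < d)%N.
Hypothesis detA : \det A != 0.
Hypothesis detB : \det B != 0.
Hypothesis A_diag : exists D : 'rV[R[i]%C]_d,
     map_mx intr A ~_{in unitmx} diag_mx D /\ forall j, `|D 0 j| != 1.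

Lemma ler_dist_average (f g : nat -> R) (dist : nat -> R) (e K eta : R) L : (0 < L)%N ->
    0 <= K -> (forall m, `|f m - g m| <= e + K * dist m) ->
    \sum_(m < L) dist m <= eta * L%:R ->
  `|L%:R^-1 * \sum_(m < L) f m - L%:R^-1 * \sum_(m < L) g m| <= e + K * eta.
Proof.
move=> L0 K0 fg dL; have LR0 : 0 < L%:R :> R by rewrite ltr0n.
rewrite -mulrBr -sumrB normrM ger0_norm ?invr_ge0 ?ler0n// mulrC ler_pdivrMr//.
rewrite (le_trans (ler_norm_sum _ _ _))//.
apply: (@le_trans _ _ (\sum_(m < L) (e + K * dist m))); first by apply: ler_sum => m _.
rewrite big_split/= sumr_const card_ord -mulr_sumr mulrDl mulr_natr lerD2l -mulrA.
by rewrite ler_wpM2l.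
Qed.

(** By invariance the integral of g is that of the orbit mean F of g. The
    latter is close to a mean of F over finitely many points, and shadowing the
    orbits of these points changes the means of g little. *)
Lemma good_list_approx (mu : prob_torus R d) (I : finType)
    (g : I -> torus R d -> R) (e : R) :
    invariant_prob R A mu -> (forall i, continuous (g i)) -> 0 < e ->
  exists L s u, @good_list R d A B L s u /\ forall i,
    `|(\int[mu]_p g i p)%R - L%:R^-1 * \sum_(m < L) g i (torus_proj (s m))| <= e.
Proof.
move=> inv gc e0; have e4 : 0 < e / 4 by lra.
have /choice[K KP] : forall i, exists K, 0 <= K /\ forall x y,
    `|g i (torus_proj x) - g i (torus_proj y)| <= e / 4 + K * l1norm (x - y).
  by move=> i; have [K K0 KP] := torus_affine_modulus (gc i) e4; exists K.
have /choice[M MP] := fun i => torus_continuous_bounded (gc i).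
pose K' := \sum_i K i; pose M' := \sum_i `|M i|.
have K'0 : 0 <= K' by apply: sumr_ge0 => i _; case: (KP i).
have KK' i : K i <= K'.
  by rewrite /K' (bigD1 i)//= lerDl; apply: sumr_ge0 => j _; case: (KP j).
have gM' i p : `|g i p| <= M'.
  rewrite (le_trans (MP i p))// (le_trans (ler_norm _))// /M' (bigD1 i)//= lerDl.
  exact: sumr_ge0.
pose eta := e / 4 / (K' + 1).
have eta0 : 0 < eta by rewrite divr_gt0// ltr_wpDl.
have K'eta : K' * eta <= e / 4.
  rewrite /eta mulrCA; apply: ler_piMr; first exact: ltW.
  by rewrite ler_pdivrMr ?ltr_wpDl// mul1r lerDl.
have [n n0 near] := good_list_near d0 detA detB A_diag eta0.
pose F i p := n%:R^-1 * \sum_(k < n) g i (iter k (toral_endo A) p).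
have nR0 : 0 < n%:R :> R by rewrite ltr0n.
have giter i k : continuous (fun p => g i (iter k (toral_endo A) p)).
  elim: k => [|k IH]; first exact: gc.
  move=> p; under eq_fun do rewrite iterSr.
  exact: (torus_continuous_comp_endo IH).
have mF i : measurable_fun setT (F i).
  apply: measurable_funM => //; apply: measurable_sum => k.
  exact: torus_continuous_measurable (giter i k).
have FM i p : `|F i p| <= M'.
  rewrite normrM ger0_norm ?invr_ge0 ?ler0n// mulrC ler_pdivrMr//.
  rewrite (le_trans (ler_norm_sum _ _ _))// mulr_natr -[n in leRHS]card_ord -sumr_const.
  by apply: ler_sum => k _.
have [N [y [N0 yP]]] := integral_finite_average mu mF FM e4.
pose x k := repr (y k) : 'cV[R]_d.
have xy k : torus_proj (x k) = y k by rewrite /x /torus_proj reprK.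
have [s [u [sgood sdist]]] := near N x N0.
exists (N * n)%N, s, u; split=> // i.
have csum k : continuous (fun p => \sum_(j < k) g i (iter j (toral_endo A) p)).
  elim: k => [|k IH].
    under eq_fun do rewrite big_ord0.
    exact: cst_continuous.
  under eq_fun do rewrite big_ord_recr/=.
  by move=> p; apply: continuousD; [exact: IH|exact: giter].
have int_sum k : (\int[mu]_p (\sum_(j < k) g i (iter j (toral_endo A) p)))%R =
    k%:R * (\int[mu]_p g i p)%R.
  elim: k => [|k IH].
    rewrite mul0r; under eq_Rintegral do rewrite big_ord0.
    by rewrite Rintegral_cst// mul0r.
  under eq_Rintegral do rewrite big_ord_recr/=.
  rewrite RintegralD//.
  - by rewrite IH Rintegral_invariant_iter// -natr1 mulrDl mul1r.
  - exact: torus_continuous_integrable (csum k).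
  - exact: torus_continuous_integrable (giter i k).
have intF : (\int[mu]_p F i p)%R = (\int[mu]_p g i p)%R.
  rewrite /F RintegralZl//; first by rewrite int_sum mulKf// gt_eqF.
  exact: torus_continuous_integrable (csum n).
have avgF : N%:R^-1 * \sum_(k < N) F i (y k) = (N * n)%:R^-1 *
    \sum_(m < N * n) g i (torus_proj (AR ^+ (m %% n) *m x (m %/ n)%N)).
  rewrite (sum_nat_mul (fun m => g i (torus_proj (AR ^+ (m %% n) *m x (m %/ n)%N)))).
  rewrite /F -mulr_sumr natrM invfM -mulrA; congr (_ * (_ * _)).
  apply: eq_bigr => k _; apply: eq_bigr => j _.
  have [-> ->] := divmod_block k (ltn_ord j).
  by rewrite -iter_toral_endo xy.
have Nn0 : (0 < N * n)%N by rewrite muln_gt0 N0.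
have := ler_dist_average Nn0 (proj1 (KP i))
  (fun m => proj2 (KP i) (s m) (AR ^+ (m %% n) *m x (m %/ n)%N)) sdist.
have := yP i; rewrite intF avgF.
have : K i * eta <= e / 4 by rewrite (le_trans _ K'eta)// ler_wpM2r// ltW.
by rewrite !ler_norml; lra.
Qed.

End Approx.

(** * Single points and bump functions *)

Section Points.
Variables (R : realType) (d : nat).
Implicit Types (x y : 'cV[R]_d) (p q : torus R d).

Lemma tdist1_lt p y (e : R) : tdist [set p] (torus_proj y) < e ->
  exists2 x, torus_proj x = p & l1norm (y - x) < e.
Proof. by apply: tdist_lt; exists p. Qed.

(** Two lifts at distance less than 1/2 from the same vector differ by an
    integer vector of norm less than 1. *)
Lemma tdist1_eq0 p q : tdist [set p] q = 0 -> q = p.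
Proof.
have [y <-] := torus_repr q => d0.
have [x xp yx] : exists2 x, torus_proj x = p & l1norm (y - x) < 1 / 2.
  by apply: tdist1_lt; rewrite d0; lra.
have [yx0|yx0] := eqVneq (l1norm (y - x)) 0.
  by rewrite -xp; congr torus_proj; apply/eqP; rewrite -subr_eq0 (l1norm_eq0 yx0).
have [x' xp' yx'] : exists2 x', torus_proj x' = p & l1norm (y - x') < l1norm (y - x).
  by apply: tdist1_lt; rewrite d0 lt_neqAle eq_sym yx0 l1norm_ge0.
have xx' : (x - x') \is a mxOver Num.int by apply/torus_projP; rewrite xp.
have [E|ne] := eqVneq (x - x') 0.
  by move: yx'; rewrite (_ : x' = x) ?ltxx//; apply/esym/eqP; rewrite -subr_eq0 E.
exfalso; have := l1norm_int_ge1 xx' ne.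
have := ler_l1normD (x - y) (y - x'); rewrite addrA subrK -(l1normN (x - y)) opprB; lra.
Qed.

Lemma measurable_torus_point p : measurable [set p].
Proof.
have C0 : [set p] !=set0 by exists p.
have -> : [set p] = setT `&` (tdist [set p]) @^-1` [set 0].
  by rewrite setTI; apply/seteqP; split=> q /=; [move=> ->; exact: tdist0|exact: tdist1_eq0].
exact: (torus_continuous_measurable (tdist_continuous C0)).
Qed.

(** Distinct points of (1/u) Z^d / Z^d are at distance at least 1/u. *)
Lemma torus_point_separation x y (u : nat) : (0 < u)%N ->
    (u%:R *: x) \is a mxOver Num.int -> (u%:R *: y) \is a mxOver Num.int ->
    forall p, tdist [set p] (torus_proj x) < (2 * u%:R)^-1 ->
    tdist [set p] (torus_proj y) < (2 * u%:R)^-1 -> torus_proj x = torus_proj y.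
Proof.
move=> u0 ux uy p /tdist1_lt[x' xp xx'] /tdist1_lt[y' yp yy'].
have v : (x' - y') \is a mxOver Num.int by apply/torus_projP; rewrite xp.
apply/torus_projP; rewrite (_ : x - y = (x' - y') + (x - x' - (y - y'))); last first.
  by apply/matrixP => i j; rewrite !mxE; lra.
apply: mxOver_intD => //.
rewrite (_ : _ - _ = 0); first exact: mxOver0.
have scale_l1 (z : 'cV[R]_d) : l1norm (u%:R *: z) = u%:R * l1norm z.
  by rewrite /l1norm mulr_sumr; apply: eq_bigr => i _; rewrite mxE normrM ger0_norm.
have uz : (u%:R *: (x - x' - (y - y'))) \is a mxOver Num.int.
  have -> : x - x' - (y - y') = (x - y) - (x' - y').
    by apply/matrixP => i j; rewrite !mxE; lra.
  rewrite scalerBr; apply: mxOver_intB; first by rewrite scalerBr; exact: mxOver_intB.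
  by apply: mxOverZ => //; exact: natr_int.
have uR : 0 < u%:R :> R by rewrite ltr0n.
have [/eqP|ne] := eqVneq (u%:R *: (x - x' - (y - y'))) 0.
  by rewrite scaler_eq0 pnatr_eq0 -leqn0 leqNgt u0 => /eqP.
have := l1norm_int_ge1 uz ne; rewrite scale_l1.
have := ler_l1normD (x - x') (- (y - y')); rewrite l1normN.
move: xx' yy'; rewrite !invfM -!(mulrC u%:R^-1) !ltr_pdivlMl//.
move=> h1 h2 h3 h4; exfalso; move: h4; rewrite leNgt => /negP; apply.
by apply: le_lt_trans (ler_wpM2l (ltW uR) h3) _; rewrite mulrDr; lra.
Qed.

(** At least 1 within distance 1/(4u) of p and 0 beyond 1/(2u): it sees at most
    one point of (1/u) Z^d / Z^d. *)
Definition bump (u : nat) p q : R := Num.max 0 (2 - 4 * u%:R * tdist [set p] q).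

Lemma bump_ge0 u p q : 0 <= bump u p q.
Proof. by rewrite /bump le_max lexx. Qed.

Lemma bump_le2 u p q : bump u p q <= 2.
Proof.
by rewrite /bump ge_max ler0n/= gerBl mulr_ge0 ?mulr_ge0// tdist_ge0//; exists p.
Qed.

Lemma bump_lipschitz u p x y :
  `|bump u p (torus_proj x) - bump u p (torus_proj y)| <= 4 * u%:R * l1norm (x - y).
Proof.
have := @tdist_lipschitz _ _ [set p] x y (ex_intro _ p erefl); rewrite /bump.
move: (tdist _ (torus_proj x)) (tdist _ (torus_proj y)) (l1norm _) => a b c abc.
have : `|4 * u%:R * a - 4 * u%:R * b| <= 4 * u%:R * c.
  by rewrite -mulrBr normrM ger0_norm ?mulr_ge0// ler_wpM2l ?mulr_ge0.
move: (4 * u%:R * a) (4 * u%:R * b) (4 * u%:R * c) => a' b' c'.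
by rewrite /Num.max !ler_norml; case: (ltP 0 (2 - a')); case: (ltP 0 (2 - b')); lra.
Qed.

Lemma bump_continuous u p : continuous (bump u p).
Proof. exact: (lipschitz_torus_continuous (bump_lipschitz u p)). Qed.

Lemma bump_gt0 u p q : (0 < u)%N -> 0 < bump u p q -> tdist [set p] q < (2 * u%:R)^-1.
Proof.
move=> u0; rewrite /bump lt_max ltxx/= subr_gt0 => h.
rewrite -[X in _ < X]mul1r ltr_pdivlMr ?mulr_gt0 ?ltr0n//; lra.
Qed.

(** A grid of mesh 1/(4 u d) comes within l1 distance 1/(4u) of every point. *)
Lemma bump_grid u : (0 < u)%N -> (0 < d)%N ->
  exists a : {ffun 'I_d -> 'I_(4 * u * d)} -> torus R d, forall p, exists c, 1 <= bump u (a c) p.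
Proof.
move=> u0 d0; pose q := (4 * u * d)%N; have q0 : (0 < q)%N by rewrite !muln_gt0 u0.
exists (fun c : {ffun 'I_d -> 'I_(4 * u * d)} =>
  torus_proj (\col_i ((c i)%:R / q%:R))) => p.
have [x xp] := torus_repr p; pose y := x - floor_vec x.
have yp : torus_proj y = p.
  by rewrite -xp; exact/torus_projDint/mxOver_intN/floor_vec_int.
have qR : 0 < q%:R :> R by rewrite ltr0n.
have y01 i : 0 <= q%:R * y i 0 < q%:R.
  have /andP[h1 h2] := floor_vec_le x i.
  by rewrite mulr_ge0//= -[X in _ < X]mulr1 ltr_pM2l.
have cq i : (Num.trunc (q%:R * y i 0)%R < q)%N.
  have /andP[h1 h2] := y01 i; rewrite -(ltr_nat R).
  by apply: le_lt_trans h2; case/andP: (truncn_itv h1).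
exists [ffun i => Ordinal (cq i)]; rewrite /bump le_max; apply/orP; right.
rewrite lerBrDl -lerBrDr; set D := tdist _ _.
suff : D <= d%:R / q%:R.
  have -> : d%:R / q%:R = (4 * u%:R)^-1 :> R.
    by rewrite /q !natrM invfM mulrA mulrC mulrA mulVf ?mul1r// pnatr_eq0 -lt0n.
  rewrite -[X in _ <= X]mul1r ler_pdivlMr ?mulr_gt0 ?ltr0n//; lra.
rewrite /D -yp; apply: le_trans (tdist_le _ _) _; first reflexivity.
apply: (@le_trans _ _ (\sum_(i < d) q%:R^-1)); last by rewrite sumr_const card_ord mulr_natl.
apply: ler_sum => i _; rewrite !mxE ffunE/=.
have /andP[h1 h2] := y01 i; have /andP[h3 h4] := truncn_itv h1.
rewrite -/(y i 0) [X in `|X - _|](_ : _ = y i 0); last by rewrite !mxE.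
rewrite -(ler_pM2l qR) -{1}(ger0_norm (ltW qR)) -normrM mulrBr mulfV ?gt_eqF//.
rewrite mulrCA mulfV ?gt_eqF// mulr1 ler_norml; move: h3 h4; rewrite -natr1; lra.
Qed.

End Points.

(** * Lebesgue measure gives no mass to the origin *)

Section LebesgueOrigin.
Variable R : realType.

Let intset : set (measurableTypeR R) := [set x | x \is a Num.int].

Let countable_intset : countable intset.
Proof.
apply: (@sub_countable _ _ _ (range (intr : int -> R))).
  by apply: subset_card_le => x /= /intrP[m ->]; exists m.
exact: sub_countable (card_image_le _ _) (countableP _).
Qed.

Let measurable_intset : measurable intset.
Proof. exact: countable_measurable. Qed.

Let uniform_intset : uniform_prob (@ltr01 R) intset = 0%E.
Proof.
rewrite /uniform_prob; apply: null_set_integral => //.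
- by apply/measurable_EFinP; apply: measurable_funTS; exact: measurable_uniform_pdf.
- exact: countable_lebesgue_measure0.
Qed.

(** A lift of the origin has an integer first coordinate. *)
Lemma lebesgue_torus_origin d : (0 < d)%N -> lebesgue_torus R d [set torus_proj 0] = 0%E.
Proof.
case: d => // d _.
pose S := [set t : d.+1.-tuple (measurableTypeR R) | intset (tnth t ord0)].
have mS : measurable S.
  have := @measurable_tnth _ (measurableTypeR R) d.+1 ord0 measurableT _ measurable_intset.
  by rewrite setTI.
apply/eqP; rewrite -measure_le0.
apply: (@le_trans _ _ (cube_prob R d.+1 S)).
  apply: (@le_measure _ _ _ (cube_prob R d.+1)
    (@tuple_torus R d.+1 @^-1` [set torus_proj 0]) S); rewrite ?inE//.
    have := @tuple_torus_measurable R d.+1 measurableT _ (measurable_torus_point (torus_proj 0)).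
    by rewrite setTI.
  move=> t /= /torus_projP /mxOverP /(_ ord0 0); rewrite !mxE subr0 /S/= /intset/=.
  exact.
rewrite [X in (X <= _)%E]
  (_ : _ = (uniform_prob (@ltr01 R) \x cube_prob R d)%E (intset `*` setT)).
  by rewrite product_measure1E// [X in (X * _)%E]uniform_intset mul0e.
rewrite /= /distribution /pushforward; congr (_ _).
apply/seteqP; split=> -[x t] /=; rewrite /S/= /cube_cons tnth0/=; by [split|case].
Qed.

Lemma lebesgue_torus_tdist d : (0 < d)%N ->
  (\int[lebesgue_torus R d]_p tdist [set torus_proj 0] p)%R <> 0.
Proof.
move=> d0; set f := tdist _ => int0.
have C0 : [set (torus_proj 0 : torus R d)] !=set0 by exists (torus_proj 0).
have fc : continuous f by exact: tdist_continuous.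
have intE : (\int[lebesgue_torus R d]_p `|(f p)%:E| = 0)%E.
  under eq_integral do rewrite gee0_abs ?lee_fin ?tdist_ge0//.
  by rewrite -[LHS]fineK ?(integrable_fin_num _ (torus_continuous_integrable _ fc))//; congr EFin.
have mf : measurable_fun setT (EFin \o f).
  by apply/measurable_EFinP; exact: torus_continuous_measurable.
have /(ae_eq_integral_abs _ measurableT mf)[N [mN N0 subN]] := intE.
have : (lebesgue_torus R d setT <= 0)%E.
  rewrite -N0 -[leRHS]adde0 -(lebesgue_torus_origin d0).
  apply: le_trans (measureU2 _ _ _) => //; last exact: measurable_torus_point.
  apply: le_measure; rewrite ?inE//.
    by apply: measurableU => //; exact: measurable_torus_point.
  move=> p _; have [fp|fp] := eqVneq (f p) 0.
    by right; exact: tdist1_eq0.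
  by left; apply: subN => /= /(_ I) [] /eqP; exact/negP.
by rewrite (_ : lebesgue_torus R d setT = 1%E) ?lee_fin ?ler10//; exact: probability_setT.
Qed.

End LebesgueOrigin.

(** * The open conditions *)

Section OpenConditions.
Variables (R : realType) (d : nat) (B : 'M[int]_d).
Implicit Types (mu : prob_torus R d) (g : torus R d -> R).

Lemma Rintegral_wstar_continuous g : continuous g ->
  continuous (fun mu : prob_torus R d => (\int[mu]_p g p)%R).
Proof.
move=> gc mu; have : nbhs mu --> mu by [].
by move/(prob_torus_cvgP mu (nbhs_filter mu)); apply.
Qed.

(** An open version of the condition that all atoms have mass less than e: the
    masses are bounded by means of finitely many functions of which one is at
    least 1 at any given point. *)
Definition small_atoms (e : R) : set (prob_torus R d) := [set mu |
  exists (I : finType) (h : I -> torus R d -> R),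
    [/\ forall i, continuous (h i), forall i p, 0 <= h i p,
        forall p, exists i, 1 <= h i p & forall i, (\int[mu]_p h i p)%R < e]].

Lemma small_atoms_open e : open (small_atoms e).
Proof.
rewrite openE => mu [I [h [hc h0 h1 he]]].
have Fmu : Filter (nbhs mu) by exact: nbhs_filter.
pose P i (nu : prob_torus R d) := (\int[nu]_p h i p)%R < e.
have : \forall nu \near mu, forall i, P i nu.
  apply: (@filter_forall _ I P (nbhs mu)) => i.
  exact: (Rintegral_wstar_continuous (hc i) (lt_nbhsl (he i))).
by apply: filterS => nu nuh; exists I, h.
Qed.

Lemma small_atoms_lt e mu p : small_atoms e mu -> (mu [set p] < e%:E)%E.
Proof.
move=> [I [h [hc h0 h1 he]]]; have [i hi] := h1 p.
have mp := measurable_torus_point p.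
apply: (@le_lt_trans _ _ (\int[mu]_q (h i q)%:E)%E).
  rewrite -[X in mu X]setIT -(integral_indic mu measurableT mp).
  apply: ge0_le_integral => //.
  - by apply/measurable_EFinP; exact: measurable_indic.
  - by apply/measurable_EFinP; exact: torus_continuous_measurable.
  - move=> q _; rewrite lee_fin indicE; case: (boolP (q \in [set p])) => [|//].
    by rewrite inE /= => ->.
have := he i; rewrite -lte_fin /Rintegral fineK//.
exact: integrable_fin_num (torus_continuous_integrable mu (hc i)).
Qed.

Definition origin_dist : torus R d -> R := tdist [set torus_proj 0].

Lemma origin_dist_continuous : continuous origin_dist.
Proof. by apply: tdist_continuous; exists (torus_proj 0). Qed.

Definition almost_return (e : R) (N : nat) : set (prob_torus R d) := [set mu |
  exists2 n, (N <= n)%N &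
    `|(\int[mu]_p origin_dist (toral_endo (B ^+ n) p))%R - (\int[mu]_p origin_dist p)%R| < e].

Lemma almost_return_open e N : open (almost_return e N).
Proof.
rewrite openE => mu [n Nn mue].
pose G (nu : prob_torus R d) :=
  `|(\int[nu]_p origin_dist (toral_endo (B ^+ n) p))%R - (\int[nu]_p origin_dist p)%R|.
have Gc : {for mu, continuous G}.
  have c1 := @Rintegral_wstar_continuous _
    (torus_continuous_comp_endo (M := B ^+ n) origin_dist_continuous) mu.
  have c2 := @Rintegral_wstar_continuous _ origin_dist_continuous mu.
  exact: cvg_norm (cvgB c1 c2).
have : \forall nu \near mu, G nu < e by exact: (Gc _ (lt_nbhsl mue)).
have Fmu : Filter (nbhs mu) by exact: nbhs_filter.
by apply: filterS => nu nue; exists n.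
Qed.

Definition non_lebesgue_mean : set (prob_torus R d) := [set mu |
  (\int[mu]_p origin_dist p)%R != (\int[lebesgue_torus R d]_p origin_dist p)%R].

Lemma non_lebesgue_mean_open : open non_lebesgue_mean.
Proof.
have /continuousP := Rintegral_wstar_continuous origin_dist_continuous.
move=> /(_ [set r | r != (\int[lebesgue_torus R d]_p origin_dist p)%R]); apply.
exact: open_neq.
Qed.

Definition generic_cond k : set (prob_torus R d) :=
  non_lebesgue_mean `&` small_atoms (k.+1%:R^-1) `&` almost_return (k.+1%:R^-1) k.

Lemma generic_cond_open k : open (generic_cond k).
Proof.
apply: openI; last exact: almost_return_open.
by apply: openI; [exact: non_lebesgue_mean_open|exact: small_atoms_open].
Qed.

Lemma generic_nonatomic mu : (forall k, generic_cond k mu) -> nonatomic mu.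
Proof.
move=> gen p; apply/eqP; rewrite eq_le measure_ge0 andbT.
apply/lee_addgt0Pr => e e0; rewrite add0e; apply: ltW.
have [[_ sa] _] := gen (Num.trunc e^-1); apply: lt_le_trans (small_atoms_lt p sa) _.
rewrite lee_fin -[leRHS]invrK lef_pV2 ?posrE ?invr_gt0 ?ltr0n//.
by rewrite ltW// truncnS_gt.
Qed.

(** The means of the distance to the origin would tend to the Lebesgue mean,
    but they return near their value for mu. *)
Lemma generic_not_cvg mu : (forall k, generic_cond k mu) ->
  ~ (push_endo (B ^+ n) mu @[n --> \oo] --> lebesgue_torus R d).
Proof.
move=> gen cv; have :=
  @prob_torus_cvgP R d (push_endo (B ^+ n) mu @[n --> \oo]) (lebesgue_torus R d) _.
move=> /(_ _)[/(_ cv) H _].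
have := H origin_dist origin_dist_continuous; set ell := (\int[_]_p _)%R => cvell.
have [[/eqP ne _] _] := gen 0%N; apply: ne; rewrite -/ell.
apply/eqP; rewrite -subr_eq0 -normr_le0; apply/ler_addgt0Pl => e e0; rewrite addr0.
have e2 : 0 < e / 2 by lra.
move/cvgrPdist_lt/(_ _ e2) : cvell => [N _ NP].
have [_ [n nk nret]] := gen (maxn N (Num.trunc (e / 2)^-1)).
have {NP} := NP n ltac:(rewrite /=; lia); rewrite /=
  Rintegral_push_endo; last exact: origin_dist_continuous.
have : ((maxn N (Num.trunc (e / 2)^-1)).+1%:R)^-1 <= e / 2.
  rewrite -[leRHS]invrK lef_pV2 ?posrE ?invr_gt0 ?ltr0n//.
  rewrite (le_trans (ltW (truncnS_gt _)))// ler_nat ltnS leq_maxr//.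
move: nret; move: (\int[mu]_p _)%R (\int[mu]_p _)%R => a b.
move: (_.+1%:R^-1) => c; rewrite !ltr_norml ler_norml; lra.
Qed.

End OpenConditions.

(** * Successive refinements of a list *)

Lemma l1norm_mulmx_le (R : realDomainType) d (M : 'M[R]_d) :
  exists2 K, 0 <= K & forall x : 'cV[R]_d, l1norm (M *m x) <= K * l1norm x.
Proof.
exists (\sum_i \sum_j `|M i j|) => [|x].
  by apply: sumr_ge0 => i _; apply: sumr_ge0.
rewrite mulr_suml; apply: ler_sum => i _; rewrite mxE mulr_suml.
apply: le_trans (ler_norm_sum _ _ _) _; apply: ler_sum => j _.
by rewrite normrM ler_wpM2l// ler_coord_l1norm.
Qed.

Section Stages.
Variables (R : realType) (d : nat) (A B : 'M[int]_d).
Hypothesis d0 : (0 < d)%N.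
Hypothesis detA : \det A != 0.
Hypothesis detB : \det B != 0.
Hypothesis A_diag : exists D : 'rV[R[i]%C]_d,
     map_mx intr A ~_{in unitmx} diag_mx D /\ forall j, `|D 0 j| != 1.
Implicit Types (g : torus R d -> R).

Definition list_mean L (s : nat -> 'cV[R]_d) g : R :=
  L%:R^-1 * \sum_(m < L) g (torus_proj (s m)).

(** Repeating the list M times and adding the fixed point 0 perturbs its mean
    by O(1/M). *)
Lemma good_list_add0 L s u M : @good_list R d A B L s u ->
  exists s', @good_list R d A B (M * L).+1 s' u /\ forall g,
    \sum_(m < (M * L).+1) g (torus_proj (s' m)) =
    M%:R * \sum_(m < L) g (torus_proj (s m)) + g (torus_proj 0).
Proof.
move=> [L0 u0 uB us inv].
pose s' m := if (m < M * L)%N then s (m %% L)%N else 0.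
have sumE g : \sum_(m < (M * L).+1) g (torus_proj (s' m)) =
    M%:R * \sum_(m < L) g (torus_proj (s m)) + g (torus_proj 0).
  rewrite big_ord_recr/= /s' ltnn; congr (_ + _).
  rewrite -[M in M%:R]card_ord -sum1_card natr_sum mulr_suml.
  under eq_bigr => m _ do rewrite ltn_ord.
  rewrite (sum_nat_mul (fun m => g (torus_proj (s (m %% L)%N)))).
  apply: eq_bigr => i _; rewrite mul1r; apply: eq_bigr => k _.
  by have [_ ->] := divmod_block i (ltn_ord k).
exists s'; split=> //; split=> // [m mM|h].
  rewrite /s'; case: ifP => _; first by rewrite us// ltn_mod.
  by rewrite scaler0 mxOver0.
rewrite sumE (sumE (h \o toral_endo A)) /= inv.
by rewrite toral_endo_proj mulmx0.
Qed.

(** If the mean of f equals ell by accident, one additional point at the zero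
    of f spoils the equality. *)
Lemma good_list_start (mu : prob_torus R d) (I : finType) (g : I -> torus R d -> R)
    (f : torus R d -> R) (ell e : R) :
    invariant_prob R A mu -> (forall i, continuous (g i)) -> 0 < e ->
    f (torus_proj 0) = 0 -> ell != 0 ->
  exists L s u, [/\ @good_list R d A B L s u,
    forall i, `|(\int[mu]_p g i p)%R - list_mean L s (g i)| <= e &
    list_mean L s f != ell].
Proof.
move=> inv gc e0 f0 ell0; have e2 : 0 < e / 2 by lra.
have [L [s [u [good sg]]]] := good_list_approx d0 detA detB A_diag inv gc e2.
(* The mean is exactly ell: the fixed point 0 is added to M copies of the list. *)
have [fell|fell] := eqVneq (list_mean L s f) ell; last first.
  by exists L, s, u; split=> // i; rewrite (le_trans (sg i))//; lra.
have L0 : (0 < L)%N by case: good.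
have LR : 0 < L%:R :> R by rewrite ltr0n.
have /choice[b bP] := fun i => torus_continuous_bounded (gc i).
pose b' := \sum_i `|b i|.
have gb i p : `|g i p| <= b'.
  rewrite (le_trans (bP i p))// (le_trans (ler_norm _))// /b' (bigD1 i)//= lerDl.
  exact: sumr_ge0.
pose M := (Num.trunc (2 * b' / (e / 2))).+1.
have [s' [good' sumE]] := good_list_add0 M good.
have meanE h : list_mean (M * L).+1 s' h =
    ((M * L)%:R * list_mean L s h + h (torus_proj 0)) / (M * L).+1%:R.
  by rewrite /list_mean sumE mulrC; congr ((_ + _) * _); rewrite natrM -mulrA mulVKf// gt_eqF.
have N0 : 0 < (M * L).+1%:R :> R by rewrite ltr0n.
exists (M * L).+1, s', u; split=> // [i|].
  have mean_b : `|list_mean L s (g i)| <= b'.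
    rewrite normrM ger0_norm ?invr_ge0 ?ler0n// mulrC ler_pdivrMr//.
    rewrite (le_trans (ler_norm_sum _ _ _))// mulr_natr -[L in leRHS]card_ord -sumr_const.
    by apply: ler_sum => k _.
  have diff : `|list_mean L s (g i) - list_mean (M * L).+1 s' (g i)| <= e / 2.
    rewrite meanE; move: mean_b; move: (list_mean L s (g i)) => a ab.
    rewrite -(ler_pM2l N0) -{1}(ger0_norm (ltW N0)) -normrM mulrBr mulrCA divff ?gt_eqF// mulr1.
    rewrite -natr1 mulrDl mul1r opprD addrACA subrr add0r.
    apply: (@le_trans _ _ (2 * b')).
      rewrite (le_trans (ler_normB _ _))//.
      by have := gb i (torus_proj 0); lra.
    rewrite -ler_pdivrMr// (le_trans (ltW (truncnS_gt _)))// natr1 ler_nat.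
    by rewrite (leq_trans (leq_pmulr M L0)).
  have := sg i; rewrite -/(list_mean L s (g i)); move: diff.
  move: (list_mean L s (g i)) (list_mean _ _ (g i)) (Rintegral _ _ _) => a a' c.
  by rewrite !ler_norml; lra.
rewrite meanE fell f0 addr0; apply/negP => /eqP E.
have : (M * L)%:R * ell = (M * L).+1%:R * ell by rewrite -{2}E mulrCA divff ?mulr1// gt_eqF.
by rewrite -natr1 mulrDl mul1r => /eqP; rewrite addrC -subr_eq subrr eq_sym (negPf ell0).
Qed.

(** A list with its denominator and a tolerance: the total distance that the
    means of 1-Lipschitz functions are still allowed to move. *)
Record stage := Stage { len : nat; pts : nat -> 'cV[R]_d; den : nat; tol : R }.

Definition stage_mean st g := list_mean (len st) (pts st) g.

Definition good_stage st := @good_list R d A B (len st) (pts st) (den st) /\ 0 < tol st.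

(** The second group of clauses states what the limit has to remember of stage
    j. The numerical bounds keep its losses below 1/(j + 1): bumps are
    4u-Lipschitz, and the means of the distance to the origin and of its
    composition with B^m together move by at most (K + 1) times the tolerance.
    *)
Definition refines j st n st' :=
  [/\ (0 < n)%N, len st' = (len st * n)%N, good_stage st',
      tol st' <= tol st / 2 &
      \sum_(m < len st') l1norm (pts st' m - pts st (m %/ n)%N) <= tol st / 2 * (len st')%:R] /\
  [/\ forall w, ((\sum_(m < len st') (torus_proj (pts st' m) == w)) * (4 * j.+1) <= len st')%N,
      4 * (den st')%:R * tol st' <= (4 * j.+1%:R)^-1 &
      exists m K, [/\ (j <= m)%N, 0 <= K,
        forall x, l1norm (map_mx intr (B ^+ m) *m x : 'cV[R]_d) <= K * l1norm x,
        forall i, (i < len st')%N ->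
          toral_endo (B ^+ m) (torus_proj (pts st' i)) = torus_proj (pts st' i) &
        (K + 1) * tol st' <= (4 * j.+1%:R)^-1]].

Lemma refines_exists j st : good_stage st -> exists n st', refines j st n st'.
Proof.
move=> [good t0]; have t2 : 0 < tol st / 2 by lra.
have [n [s' [u' [n0 good' gap atoms]]]] :=
  good_list_refine d0 detA detB A_diag (4 * j.+1) good t2.
have [m jm fixm] := good_list_recurrent good' j.
have [K K0 KP] := l1norm_mulmx_le (map_mx intr (B ^+ m) : 'M[R]_d).
have u'0 : (0 < u')%N by case: good'.
have j0 : 0 < (4 * j.+1%:R)^-1 :> R by rewrite invr_gt0 mulr_gt0.
pose t1 := (4 * j.+1%:R)^-1 / (4 * u'%:R) : R.
pose t3 := (4 * j.+1%:R)^-1 / (K + 1) : R.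
have t10 : 0 < t1 by rewrite divr_gt0// mulr_gt0// ltr0n.
have t30 : 0 < t3 by rewrite divr_gt0// ltr_wpDl.
pose t := Num.min (tol st / 2) (Num.min t1 t3).
have tle1 : t <= t1 by rewrite /t !ge_min lexx orbT.
have tle3 : t <= t3 by rewrite /t !ge_min lexx !orbT.
exists n, (Stage (len st * n) s' u' t); split; split=> //=.
- by split=> //=; rewrite /t !lt_min t2 t10.
- by rewrite /t ge_min lexx.
- by move: tle1; rewrite /t1 ler_pdivlMr ?mulr_gt0 ?ltr0n// mulrC.
- exists m, K; split=> //.
  by move: tle3; rewrite /t3 ler_pdivlMr ?ltr_wpDl// mulrC.
Qed.

Lemma refining_sequence st0 : good_stage st0 -> exists (st : nat -> stage) (n : nat -> nat),
  st 0%N = st0 /\ forall j, refines j (st j) (n j) (st j.+1).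
Proof.
move=> good0.
have /choice[step stepP] : forall jst : nat * stage, exists nst : nat * stage,
    good_stage jst.2 -> refines jst.1 jst.2 nst.1 nst.2.
  move=> [j st]; have [good|ng] := pselect (good_stage st); last by exists (0%N, st).
  by have [n [st' H]] := refines_exists j good; exists (n, st').
pose st := fix st j := if j is j'.+1 then (step (j', st j')).2 else st0.
have good j : good_stage (st j).
  elim: j => [//|j IH]; by have [[]] := stepP (j, st j) IH.
by exists st, (fun j => (step (j, st j)).1); split=> // j; exact: (stepP (j, st j) (good j)).
Qed.

End Stages.

(** * The limit measure *)

Section LimitMeasure.
Variables (R : realType) (d : nat) (A B : 'M[int]_d).
Hypothesis d0 : (0 < d)%N.
Implicit Types (g : torus R d -> R).
Variables (st : nat -> stage R d) (n : nat -> nat).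
Hypothesis good0 : good_stage A B (st 0%N).
Hypothesis tol0 : tol (st 0%N) <= 1.
Hypothesis refine : forall j, refines A B j (st j) (n j) (st j.+1).

Let good j : good_stage A B (st j).
Proof. by case: j => // j; have [[]] := refine j. Qed.

Let tol_gt0 j : 0 < tol (st j).
Proof. by case: (good j). Qed.

Let len_gt0 j : (0 < len (st j))%N.
Proof. by case: (good j) => -[]. Qed.

(** Since the tolerances at least halve, the tolerance at stage j dominates the
    sum of all later displacements. *)
Lemma stage_drift j i : exists N, [/\ (0 < N)%N, len (st (j + i)) = (len (st j) * N)%N &
  \sum_(m < len (st (j + i))) l1norm (pts (st (j + i)) m - pts (st j) (m %/ N)%N) <=
    (tol (st j) - tol (st (j + i))) * (len (st (j + i)))%:R].
Proof.
elim: i => [|i [N [N0 LN IH]]].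
  exists 1%N; rewrite addn0 muln1; split=> //.
  rewrite subrr mul0r big1// => m _.
  by rewrite divn1 subrr l1norm0.
rewrite addnS; have [[n0 LS _ tolS gap] _] := refine (j + i).
exists (N * n (j + i))%N; rewrite muln_gt0 N0 n0; split=> //.
  by rewrite LS LN mulnA.
set s := pts (st j); set s' := pts (st (j + i)) in IH gap; set s'' := pts _ in gap *.
set n' := n (j + i) in LS n0 gap *.
have : \sum_(m < len (st (j + i).+1)) l1norm (s' (m %/ n')%N - s (m %/ n' %/ N)%N) <=
    (tol (st j) - tol (st (j + i))) * (len (st (j + i).+1))%:R.
  rewrite LS (sum_nat_mul (fun m => l1norm (s' (m %/ n')%N - s (m %/ n' %/ N)%N))).
  under eq_bigr => a _.
    under eq_bigr => b _ do have [-> _] := divmod_block a (ltn_ord b).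
    rewrite sumr_const card_ord.
    over.
  by rewrite sumrMnl -[leLHS]mulr_natr natrM mulrA ler_pM2r ?ltr0n.
have tri m : l1norm (s'' m - s (m %/ (N * n'))%N) <=
    l1norm (s'' m - s' (m %/ n')%N) + l1norm (s' (m %/ n')%N - s (m %/ n' %/ N)%N).
  by rewrite mulnC divnMA (le_trans _ (ler_l1normD _ _))// addrA subrK.
move=> h; apply: (@le_trans _ _ _ _ _ (ler_sum _ (fun m _ => tri (val m)))).
rewrite big_split/=; apply: le_trans (lerD gap h) _.
rewrite -mulrDl ler_wpM2r//; move: tolS; lra.
Qed.

Lemma stage_mean_drift g (e K : R) j i : 0 <= K ->
    (forall x y, `|g (torus_proj x) - g (torus_proj y)| <= e + K * l1norm (x - y)) ->
  `|stage_mean (st (j + i)) g - stage_mean (st j) g| <= e + K * tol (st j).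
Proof.
move=> K0 gK; have [N [N0 LN drift]] := stage_drift j i.
have drift' : \sum_(m < len (st (j + i))) l1norm (pts (st (j + i)) m - pts (st j) (m %/ N)%N) <=
    tol (st j) * (len (st (j + i)))%:R.
  by apply: le_trans drift _; rewrite ler_wpM2r// gerBl ltW.
have := ler_dist_average (len_gt0 (j + i)) K0
  (fun m => gK (pts (st (j + i)) m) (pts (st j) (m %/ N)%N)) drift'.
rewrite /stage_mean /list_mean; congr (`|_ - _| <= _).
rewrite LN (sum_nat_mul (fun m => g (torus_proj (pts (st j) (m %/ N)%N)))).
rewrite natrM invfM -mulrA; congr (_ * _); rewrite mulr_sumr; apply: eq_bigr => a _.
under eq_bigr => b _ do have [-> _] := divmod_block a (ltn_ord b).
by rewrite sumr_const card_ord -[X in _ * X = _]mulr_natl mulKf// pnatr_eq0 -lt0n.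
Qed.

Lemma limit_exists : exists nu : prob_torus R d, forall g, continuous g ->
  stage_mean (st j) g @[j --> \oo] --> (\int[nu]_p g p)%R.
Proof.
have tolX j : tol (st j) <= (2^-1) ^+ j.
  elim: j => [|j IH]; first by rewrite expr0.
  have [[_ _ _ tolS _] _] := refine j; rewrite exprS; move: tolS IH; lra.
apply: (@list_limit R d (fun j => len (st j)) n (fun j => pts (st j))) => //.
  by move=> j; have [[]] := refine j.
move=> j; have [[_ _ _ _ gap] _] := refine j; apply: le_trans gap _.
rewrite ler_wpM2r//; have := tolX j; have := tol_gt0 j; lra.
Qed.

Variable nu : prob_torus R d.
Hypothesis nu_lim : forall g, continuous g ->
  stage_mean (st j) g @[j --> \oo] --> (\int[nu]_p g p)%R.

(** Compare the stage j with a stage i, uniformly in i, and let i tend to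
    infinity. *)
Lemma limit_near_stage g (e K : R) j : continuous g -> 0 <= K ->
    (forall x y, `|g (torus_proj x) - g (torus_proj y)| <= e + K * l1norm (x - y)) ->
  `|(\int[nu]_p g p)%R - stage_mean (st j) g| <= e + K * tol (st j).
Proof.
move=> gc K0 gK.
have cv : `|stage_mean (st i) g - stage_mean (st j) g| @[i --> \oo] -->
    `|(\int[nu]_p g p)%R - stage_mean (st j) g|.
  by apply: cvg_norm; apply: cvgB; [exact: nu_lim|exact: cvg_cst].
rewrite -(cvg_lim _ cv)//; apply: limr_le; first by apply/cvg_ex; eexists; exact: cv.
near=> i; have ji : (j <= i)%N by near: i; exact: nbhs_infty_ge.
by rewrite -(subnKC ji); exact: stage_mean_drift.
Unshelve. all: by end_near. Qed.

Lemma limit_invariant : invariant_prob R A nu.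
Proof.
apply: invariant_prob_criterion => g gc.
have := nu_lim (torus_continuous_comp_endo (M := A) gc).
rewrite (_ : (fun j => _) = (fun j => stage_mean (st j) g)).
  by move=> /cvg_unique; apply=> //; exact: nu_lim.
apply/funext => j; rewrite /stage_mean /list_mean; congr (_ * _).
by have [[_ _ _ _ inv] _] := good j; exact: inv.
Qed.

Let origin_dist_lipschitz (x y : 'cV[R]_d) :
  `|origin_dist (torus_proj x) - origin_dist (torus_proj y)| <= 0 + 1 * l1norm (x - y).
Proof. by rewrite add0r mul1r tdist_lipschitz//; exists (torus_proj 0). Qed.

(** A bump at the scale of the stage meets at most one torus point of the list,
    and that point is a small fraction of the list. *)
Lemma limit_small_atoms k : small_atoms (k.+1%:R^-1) nu.
Proof.
have [[_ _ [good' _] _ _] [atoms tolu _]] := refine k.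
move: (st k.+1) good' atoms tolu (fun g e K => @limit_near_stage g e K k.+1) => stk.
move=> [L0 u0 _ us _] atoms tolu near.
have [a aP] := bump_grid R u0 d0.
exists {ffun 'I_d -> 'I_(4 * den stk * d)}, (fun c => bump (den stk) (a c)); split => //.
- by move=> c; exact: bump_continuous.
- by move=> c p; exact: bump_ge0.
move=> c; set h := bump _ _.
have LR : 0 < (len stk)%:R :> R by rewrite ltr0n.
(* The bump is at most 2, and the points it sees coincide on the torus, so that
   they make up at most 1 / (4 (k + 1)) of the list. *)
have mean_h : stage_mean stk h <= (2 * k.+1%:R)^-1.
  rewrite /stage_mean /list_mean mulrC ler_pdivrMr//.
  have [[m hm]|none] := pselect
      (exists m : 'I_(len stk), 0 < h (torus_proj (pts stk m))); last first.
    rewrite big1 => [|m _]; first by rewrite mulr_ge0// ?invr_ge0 ?mulr_ge0.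
    apply/eqP; rewrite eq_le bump_ge0 andbT leNgt; apply/negP => hm.
    by apply: none; exists m.
  have := atoms (torus_proj (pts stk m)); set w := torus_proj _ => count_le.
  apply: (@le_trans _ _ (\sum_(i < len stk) 2 * (torus_proj (pts stk i) == w)%:R)).
    apply: ler_sum => i _; have [_|ne] := eqVneq (torus_proj (pts stk i)) w.
      by rewrite mulr1 bump_le2.
    rewrite mulr0 leNgt; apply/negP => hi; move/eqP: ne; apply.
    apply: (torus_point_separation u0 (us i (ltn_ord i)) (us m (ltn_ord m)) (p := a c));
      exact: bump_gt0.
  rewrite -mulr_sumr -natr_sum mulrC ler_pdivlMl ?mulr_gt0//.
  move: count_le; rewrite -(ler_nat R) !natrM; lra.
have hL (x y : 'cV[R]_d) : `|h (torus_proj x) - h (torus_proj y)| <=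
    0 + 4 * (den stk)%:R * l1norm (x - y).
  by rewrite add0r; exact: bump_lipschitz.
have := near h 0 (4 * (den stk)%:R) (@bump_continuous R d (den stk) (a c)) _ hL.
move=> /(_ ltac:(by rewrite mulr_ge0)).
have k0 : 0 < k.+1%:R^-1 :> R by rewrite invr_gt0.
move: mean_h tolu; rewrite !invfM.
move: (k.+1%:R^-1) (stage_mean _ _) (Rintegral _ _ _) k0 => kk a' c' kk0.
by rewrite ler_norml; lra.
Qed.

(** Some B^m fixes every point of the list, so both means agree on the list
    exactly. *)
Lemma limit_almost_return k : almost_return B (k.+1%:R^-1) k nu.
Proof.
have [_ [_ _ [m [K [km K0 KP fixm tolK]]]]] := refine k; exists m => //.
set f := fun p => origin_dist (toral_endo (B ^+ m) p).
have fc : continuous f.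
  exact: (torus_continuous_comp_endo (M := B ^+ m) (@origin_dist_continuous R d)).
have fL (x y : 'cV[R]_d) : `|f (torus_proj x) - f (torus_proj y)| <= 0 + K * l1norm (x - y).
  rewrite /f !toral_endo_proj; apply: le_trans (origin_dist_lipschitz _ _) _.
  by rewrite !add0r mul1r -mulmxBr; exact: KP.
have meanE : stage_mean (st k.+1) f = stage_mean (st k.+1) (@origin_dist R d).
  rewrite /stage_mean /list_mean; congr (_ * _); apply: eq_bigr => i _.
  by rewrite /f fixm.
have := limit_near_stage k.+1 fc K0 fL.
have := limit_near_stage k.+1 (@origin_dist_continuous R d) ler01 origin_dist_lipschitz.
rewrite meanE.
have k0 : 0 < k.+1%:R^-1 :> R by rewrite invr_gt0.
move: tolK; rewrite invfM.
move: (k.+1%:R^-1) (stage_mean _ _) (Rintegral nu _ f) (Rintegral _ _ _) k0 => kk a b c kk0.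
by rewrite !ler_norml ltr_norml mulrDl; lra.
Qed.

Lemma limit_non_lebesgue :
    tol (st 0%N) < `|stage_mean (st 0%N) (@origin_dist R d) -
      (\int[lebesgue_torus R d]_p origin_dist p)%R| ->
  non_lebesgue_mean nu.
Proof.
move=> h; apply/eqP => E; move: h; rewrite -E distrC ltNge => /negP; apply.
have := limit_near_stage 0%N (@origin_dist_continuous R d) ler01 origin_dist_lipschitz.
by rewrite add0r mul1r.
Qed.

Lemma limit_generic k :
    tol (st 0%N) < `|stage_mean (st 0%N) (@origin_dist R d) -
      (\int[lebesgue_torus R d]_p origin_dist p)%R| ->
  generic_cond B k nu.
Proof.
move=> h; split; [split|].
- exact: limit_non_lebesgue.
- exact: limit_small_atoms.
- exact: limit_almost_return.
Qed.

End LimitMeasure.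

(** * Density and conclusion *)

(** The neighbourhoods given by finitely many means form a filter that
    converges to mu, hence it contains every neighbourhood of mu. *)
Lemma wstar_nbhs_basis (R : realType) d (mu : prob_torus R d) (U : set (prob_torus R d)) :
  nbhs mu U -> exists (I : finType) (g : I -> torus R d -> R) (e : R),
    [/\ forall i, continuous (g i), 0 < e &
      forall nu : prob_torus R d,
        (forall i, `|(\int[mu]_p g i p)%R - (\int[nu]_p g i p)%R| <= e) -> U nu].
Proof.
pose F : set_system (prob_torus R d) := [set V |
  exists (I : finType) (g : I -> torus R d -> R) (e : R),
    [/\ forall i, continuous (g i), 0 < e &
      forall nu : prob_torus R d,
        (forall i, `|(\int[mu]_p g i p)%R - (\int[nu]_p g i p)%R| <= e) -> V nu]].
have FF : Filter F.
  split=> [|V W [I [g [e [gc e0 gV]]]] [J [h [e' [hc e'0 hW]]]]|V W VW [I [g [e [gc e0 gV]]]]].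
  - by exists void, (fun _ _ => 0), 1; split=> // -[].
  - exists (I + J)%type, (fun i => match i with inl i => g i | inr j => h j end), (Num.min e e').
    split=> [[i|j]||nu near].
    + exact: gc.
    + exact: hc.
    + by rewrite lt_min e0.
    + split.
        by apply: gV => i; rewrite (le_trans (near (inl i)))// ge_min lexx.
      by apply: hW => j; rewrite (le_trans (near (inr j)))// ge_min lexx orbT.
  - by exists I, g, e; split=> // nu near; apply: VW; exact: gV.
suff : F --> mu by move=> Fmu /Fmu.
apply/(prob_torus_cvgP mu FF) => f fc; apply/cvgrPdist_le => e e0.
by exists unit, (fun=> f), e; split=> // nu /(_ tt).
Qed.

Local Open Scope complex_scope.

Theorem theorem1p8 (R : realType) (d : nat) (A B : 'M[int]_d)
  (d_ge2 : (2 <= d)%N) (detA : \det A != 0) (detB : \det B != 0)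
  (A_diag : exists D : 'rV[R[i]]_d,
     map_mx intr A ~_{in unitmx} diag_mx D /\ forall j, `|D 0 j| != 1)
  (AB : coprimez (\det A) (\det B) \/ (is_trig_mx A \/ is_trig_mx A^T)) :
  residual [set mu : invariant_prob R A | nonatomic (set_val mu) /\
    ~ (push_endo (B ^+ n) (set_val mu) @[n --> \oo] --> lebesgue_torus R d)].
Proof.
have d0 : (0 < d)%N := ltnW d_ge2.
pose U k : set (invariant_prob R A) := set_val @^-1` generic_cond B k.
exists (\bigcap_k U k); split.
- exists U => // k.
  have /continuousP := @initial_continuous (invariant_prob R A) (prob_torus R d) set_val.
  by apply; exact: generic_cond_open.
- move=> O [mu Omu] [V oV VO]; rewrite -VO in Omu *.
  have [I [g [e [gc e0 gV]]]] := wstar_nbhs_basis (open_nbhs_nbhs (conj oV Omu)).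
  have mu_inv : invariant_prob R A (set_val mu) by exact: set_valP.
  have e2 : 0 < e / 4 by lra.
  set ell := (\int[lebesgue_torus R d]_p origin_dist p)%R.
  have ell0 : ell != 0 by apply/eqP; exact: lebesgue_torus_tdist.
  have [L [s [u [good sg sf]]]] := good_list_start d0 detA detB A_diag mu_inv gc e2
    (tdist0 erefl : origin_dist (torus_proj 0) = 0) ell0.
  have /choice[K KP] : forall i, exists K, 0 <= K /\ forall x y,
      `|g i (torus_proj x) - g i (torus_proj y)| <= e / 4 + K * l1norm (x - y).
    by move=> i; have [K K0 KP] := torus_affine_modulus (gc i) e2; exists K.
  pose K' := \sum_i K i.
  have K'0 : 0 <= K' by apply: sumr_ge0 => i _; case: (KP i).
  have KK' i : K i <= K'.
    by rewrite /K' (bigD1 i)//= lerDl; apply: sumr_ge0 => j _; case: (KP j).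
  pose dl := `|list_mean L s (@origin_dist R d) - ell|.
  have dl0 : 0 < dl by rewrite normr_gt0 subr_eq0.
  (* A tolerance at most 1 makes the displacements summable, one below dl keeps the
     mean of the distance to the origin off ell, and the last one keeps the means
     of the g i close to those of mu. *)
  pose t := Num.min 1 (Num.min (dl / 2) (e / 4 / (K' + 1))).
  have t0 : 0 < t by rewrite !lt_min ltr01 !divr_gt0// ltr_wpDl.
  have td : t < dl by apply: (@le_lt_trans _ _ (dl / 2)); [rewrite !ge_min lexx !orbT|lra].
  have tK : (K' + 1) * t <= e / 4.
    rewrite mulrC -ler_pdivlMr ?ltr_wpDl//.
    by rewrite !ge_min lexx !orbT.
  have [st [n [st0 refine]]] := refining_sequence d0 detA detB A_diag
    (conj good t0 : good_stage A B (Stage L s u t)).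
  have good0 : good_stage A B (st 0%N) by rewrite st0.
  have tol1 : tol (st 0%N) <= 1 by rewrite st0 /= ge_min lexx.
  have [nu nu_lim] := limit_exists good0 tol1 refine.
  have nu_inv := limit_invariant good0 refine nu_lim.
  exists (exist _ nu (mem_set nu_inv)); split; last first.
    by move=> k _; apply: (limit_generic d0 good0 refine nu_lim); rewrite st0.
  apply: gV => i; rewrite set_valE /=.
  have [Ki0 gK] := KP i.
  have := limit_near_stage good0 refine nu_lim 0%N (gc i) Ki0 gK.
  have := sg i; rewrite st0 /stage_mean /=.
  have : K i * t <= e / 4.
    by apply: le_trans tK; rewrite ler_wpM2r// ?(ltW t0)// (le_trans (KK' i))// lerDl.
  move: (list_mean _ _ _) (Rintegral nu _ _) (Rintegral _ _ _) => a b c.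
  by rewrite !ler_norml; lra.
- move=> mu gen; split.
    by apply: (@generic_nonatomic R d B) => k; exact: gen.
  by apply: generic_not_cvg => k; exact: gen.
Qed.
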